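(* Let $M$ be a manifold modeled on a Banach space $\mathbb{E}$, let $L:\mathbb{R}\times TM\to\mathbb{R}$ be a regular time dependent Lagrangian, let $E_L:=\Gamma L-L$ be the energy of $L$, and let $\Omega_L=\omega_L+dE_L\wedge dt$. Then: (i) There is a unique semispray $Z\in\mathfrak{X}(\mathbb{R}\times TM)$ for which $i_Z\,dt=1$ and $i_Z\Omega_L=0$. (ii) A curve $c(s)$ in $M$ is a geodesic of $Z$ if and only if it satisfies the Euler–Lagrange equation $$\frac{d}{ds}\big\{\partial_3L\big(s,c(s),c'(s)\big)[c'(s)]\big\}=\partial_2L\big(s,c(s),c'(s)\big)[c'(s)].$$
   Context: All manifolds and maps are smooth; $M$ is modeled on a (possibly infinite dimensional) real Banach space $\mathbb{E}$. In a chart $U\subseteq\mathbb{E}$ of $M$, points of $\mathbb{R}\times TM$ are written $(t,x,y)\in\mathbb{R}\times U\times\mathbb{E}$, tangent vectors to $\mathbb{R}\times TM$ are written $(t,x,y;s,z,w)$, and $\partial_i$ is the partial derivative in the $i$-th variable. The equation in (ii) is understood in such local coordinates. A time dependent Lagrangian is a smooth map $L:\mathbb{R}\times TM\to\mathbb{R}$; it is regular if at every point the bilinear form $\partial_3^2L(t,x,y)$ on $\mathbb{E}$ is (strongly) nondegenerate, i.e. $y'\mapsto\partial_3^2L(t,x,y)(y',\cdot)$ is an isomorphism $\mathbb{E}\to\mathbb{E}^*$. $\Gamma$ is the Liouville vector field, locally $\Gamma(t,x,y)=(t,x,y;0,0,y)$, so $E_L(t,x,y)=\partial_3L(t,x,y)y-L(t,x,y)$.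 The canonical tangent structure is $J(t,x,y;s,z,w)=(t,x,y;0,0,z)$, $\theta_L:=dL\circ J$ (locally $\theta_L(t,x,y)(s,z,w)=\partial_3L(t,x,y)z$), and $\omega_L:=-d\theta_L$. Conventions: $d\theta(X,Y)=X\theta(Y)-Y\theta(X)-\theta([X,Y])$ and $(\alpha\wedge\beta)(X,Y)=\alpha(X)\beta(Y)-\alpha(Y)\beta(X)$; $t$ is the coordinate on the factor $\mathbb{R}$. A (time dependent) semispray is a vector field on $\mathbb{R}\times TM$ which in every chart has the form $(t,x,y)\mapsto(t,x,y;1,y,-G(t,x,y))$. A curve $c$ in $M$ is a geodesic of it if in charts $c''(s)+G(s,c(s),c'(s))=0$.
   Formalization: In (ii) the Euler–Lagrange equation is taken as the covector equation d/ds{∂₃L(s,c,c')} = ∂₂L(s,c,c') in E^*, without the argument [c'(s)]; as printed, the scalar equation fails, e.g. for L=|y|²/2 on R² and the unit circle. *)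

(* Defs.v *)
From HB Require Import structures.
From mathcomp Require Import all_boot all_order all_algebra.
From mathcomp Require Import all_classical all_reals all_analysis.
Set Implicit Arguments. Unset Strict Implicit. Unset Printing Implicit Defensive.
Import Order.TTheory GRing.Theory Num.Theory.
Import numFieldNormedType.Exports.
Local Open Scope classical_set_scope.
Local Open Scope ring_scope.

Section clin.
Context {R : realType}.
Implicit Types V W : normedModType R.

Definition clin_pred V W : {pred V -> W} :=
  [pred f : V -> W | `[< linear f /\ continuous f >]].

Lemma clin_submod V W : submod_closed (@clin_pred V W).
Proof.
split.
  by apply/asboolP; split=> [a u v|x]; [rewrite /= scaler0 addr0|exact: cvg_cst].
move=> a f g /asboolP[lf cf] /asboolP[lg cg]; apply/asboolP; split=> [b u v|x].
  rewrite !fctE lf lg !scalerDr !scalerA [a * b]mulrC -!addrA; congr (_ + _).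
  by rewrite addrCA.
apply: cvgD; last exact: cg.
by apply: cvgZl_tmp; exact: cf.
Qed.

HB.instance Definition _ V W :=
  GRing.isSubmodClosed.Build R (V -> W) (@clin_pred V W) (@clin_submod V W).

Record clin V W := Clin { clin_fun :> V -> W ; _ : clin_fun \in @clin_pred V W }.

HB.instance Definition _ V W := [isSub for @clin_fun V W].
HB.instance Definition _ V W := [Choice of clin V W by <:].
HB.instance Definition _ V W := [SubChoice_isSubLmodule of clin V W by <:].

Definition op_norm V W (f : clin V W) : R :=
  sup [set `|f x| | x in [set x : V | `|x| <= 1]].

Lemma clin_linear V W (f : clin V W) : linear f.
Proof. by case: f => f /= /asboolP[]. Qed.

HB.instance Definition _ V W (f : clin V W) :=
  GRing.isLinear.Build R V W *:%R f (clin_linear f).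

Lemma clin_continuous V W (f : clin V W) : continuous f.
Proof. by case: f => f /= /asboolP[]. Qed.

Lemma op_norm_has_sup V W (f : clin V W) :
  has_sup [set `|f x| | x in [set x : V | `|x| <= 1]].
Proof.
split; first by exists `|f 0|, 0 => //=; rewrite normr0.
have /linear_bounded_continuous/bounded_funP/(_ 1)[M fM] := @clin_continuous _ _ f.
by exists M => _ [x /= x1 <-]; exact: fM.
Qed.

Lemma op_norm_ub V W (f : clin V W) x : `|x| <= 1 -> `|f x| <= op_norm f.
Proof.
by move=> x1; apply: ub_le_sup; [case: (op_norm_has_sup f)|exists x].
Qed.

Lemma op_norm_le V W (f : clin V W) (M : R) :
  (forall x, `|x| <= 1 -> `|f x| <= M) -> op_norm f <= M.
Proof.
move=> fM; apply: ge_sup; first by case: (op_norm_has_sup f).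
by move=> _ [x x1 <-]; exact: fM.
Qed.

Lemma op_normD V W (f g : clin V W) : op_norm (f + g) <= op_norm f + op_norm g.
Proof.
apply: op_norm_le => x x1.
by rewrite (le_trans (ler_normD _ _))// lerD// op_norm_ub.
Qed.

Lemma op_normZ V W (a : R) (f : clin V W) : op_norm (a *: f) = `|a| * op_norm f.
Proof.
have le b (g : clin V W) : op_norm (b *: g) <= `|b| * op_norm g.
  by apply: op_norm_le => x x1; rewrite normrZ ler_wpM2l ?op_norm_ub.
have [->|a0] := eqVneq a 0.
  apply/eqP; rewrite normr0 mul0r scale0r eq_le; apply/andP; split.
    by apply: op_norm_le => x _; rewrite normr0.
  by rewrite (le_trans _ (@op_norm_ub _ _ 0 0 _)) ?normr0.
apply/eqP; rewrite eq_le le/= -ler_pdivlMl ?normr_gt0// -normfV.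
by rewrite -{1}[f](scalerK a0) le.
Qed.

Lemma op_norm_eq0 V W (f : clin V W) : op_norm f = 0 -> f = 0.
Proof.
move=> f0; apply: val_inj; apply/funext => x /=.
have [->|x0] := eqVneq x 0; first exact: linear0.
have: `|f (`|x|^-1 *: x)| <= 0.
  by rewrite -f0 op_norm_ub// normrZV ?unitfE ?normr_eq0.
rewrite linearZ normrZ pmulr_rle0 ?normr_gt0 ?invr_eq0 ?normr_eq0//.
by rewrite normr_le0 => /eqP.
Qed.

HB.instance Definition _ V W :=
  Lmodule_isNormed.Build R (clin V W) (@op_normD V W) (@op_normZ V W)
    (@op_norm_eq0 V W).

End clin.

Section smoothness.
Context {R : realType}.

(* The Frechet derivative as a map into the Banach space of bounded operators.
   The default value 0 of insubd is only reached where f is not differentiable. *)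
Definition Dop (V W : normedModType R) (f : V -> W) (x : V) : clin V W :=
  insubd 0 ('d f x : V -> W).

Fixpoint Ck_on (n : nat) (V W : normedModType R) (U : set V) (f : V -> W)
    : Prop :=
  if n is m.+1 then
    (forall x, U x -> differentiable f x) /\ Ck_on m U (Dop f)
  else forall x, U x -> {for x, continuous f}.

(* Only meaningful for open U. *)
Definition smooth_on (V W : normedModType R) (U : set V) (f : V -> W) : Prop :=
  forall n, Ck_on n U f.

Definition is_toplinear_iso (V W : normedModType R) (A : clin V W) : Prop :=
  exists B : clin W V, cancel A B /\ cancel B A.

Lemma DopE (V W : normedModType R) (f : V -> W) x :
  differentiable f x -> Dop f x = 'd f x :> (V -> W).
Proof.
move=> df; rewrite /Dop /insubd insubT//.
by apply/asboolP; split; [exact: linearP|exact: diff_continuous].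
Qed.

Lemma smooth_differentiable (V W : normedModType R) (U : set V) (f : V -> W) x :
  smooth_on U f -> U x -> differentiable f x.
Proof. by move=> /(_ 1%N)[+ _]; exact. Qed.

End smoothness.

(* Manifolds given by an atlas on a bare set, as in Lang's book: the topology is
   the one generated by the atlas, and no separation axiom is imposed. [pt c] is
   the inverse of the chart map [coord c]; only its values on the image
   [cod c] of the chart matter. *)
Record charted (R : realType) (V : normedModType R) := Charted {
  carrier :> Type ;
  chart : Type ;
  dom : chart -> set carrier ;
  coord : chart -> carrier -> V ;
  pt : chart -> V -> carrier ;
  dom_cover : forall p, exists c, dom c p ;
  coordK : forall c p, dom c p -> pt c (coord c p) = p ;
  overlap_open : forall c d, open (coord c @` (dom c `&` dom d)) }.

Section charted.
Context {R : realType} {V : normedModType R} (N : charted V).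
Implicit Types (c d e : chart N) (p : N).

Definition cod c : set V := coord c @` dom c.

Definition trans c d : V -> V := coord d \o pt c.

Definition smooth_atlas : Prop :=
  forall c d, smooth_on (coord c @` (dom c `&` dom d)) (trans c d).

(* A class of triples (chart at p, p, vector of V) is given by its family of
   representatives, one in each chart at p; charts away from p get 0, so that
   equal tangent vectors are equal terms. *)
Record tangent p := Tangent {
  tcoord : chart N -> V ;
  tcoord_trans : forall c d, dom c p -> dom d p ->
    tcoord d = 'd (trans c d) (coord c p) (tcoord c) ;
  tcoord_out : forall c, ~ dom c p -> tcoord c = 0 }.

Definition smooth_fun (f : N -> R) : Prop :=
  forall c, smooth_on (cod c) (f \o pt c).

Record vector_field := VectorField {
  vf :> forall p, tangent p ;
  vf_smooth : forall c, smooth_on (cod c) (fun x => tcoord (vf (pt c x)) c) }.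

Definition fun_loc (f : N -> R) c : V -> R := f \o pt c.
Definition vf_loc (X : vector_field) c : V -> V := fun x => tcoord (X (pt c x)) c.

(* On an open set I; openness of the preimages of charts is continuity. *)
Definition smooth_curve (I : set R) (g : R -> N) : Prop :=
  forall c, open (I `&` g @^-1` dom c) /\
    smooth_on (I `&` g @^-1` dom c) (coord c \o g).

Lemma tangent_eq p (v w : tangent p) : tcoord v = tcoord w -> v = w.
Proof.
case: v w => [v v1 v2] [w w1 w2] /= vw; rewrite vw in v1 v2 *.
by rewrite (Prop_irrelevance v1 w1) (Prop_irrelevance v2 w2).
Qed.

End charted.

Record manifold (R : realType) (E : completeNormedModType R) := Manifold {
  manifold_charted :> charted E ;
  manifold_smooth : smooth_atlas manifold_charted }.

Section tangent_bundle.
Context {R : realType} {E : completeNormedModType R} (M : manifold E).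
Implicit Types (c d e : chart M) (p : M).

Lemma trans_differentiable c d p : dom c p -> dom d p ->
  differentiable (trans c d) (coord c p).
Proof.
move=> cp dp; apply: smooth_differentiable (@manifold_smooth _ _ M c d) _.
by exists p.
Qed.

Lemma trans_coord c d p : dom c p -> trans c d (coord c p) = coord d p.
Proof. by move=> cp; rewrite /trans/= coordK. Qed.

Lemma diff_transK c d e p y : dom c p -> dom d p -> dom e p ->
  'd (trans d e) (coord d p) ('d (trans c d) (coord c p) y) =
  'd (trans c e) (coord c p) y.
Proof.
move=> cp dp ep.
have dcd := trans_differentiable cp dp.
have dce := trans_differentiable cp ep.
have dde : differentiable (trans d e) (trans c d (coord c p)).
  by rewrite trans_coord//; exact: trans_differentiable.
rewrite -[in LHS](trans_coord d cp).
have := diff_comp dcd dde => /(congr1 (fun f => f y)) /= <-.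
rewrite -!deriveE//; last exact: differentiable_comp.
apply: near_eq_derive.
have := open_nbhs_nbhs (conj (@overlap_open _ _ M c d) _) => /(_ (coord c p)).
move=> /(_ (ex_intro2 _ _ p (conj cp dp) erefl)).
apply: filterS => _ [q [cq dq] <-] /=.
by rewrite trans_coord// /trans/= !coordK.
Qed.

Lemma diff_trans_id c p y : dom c p -> 'd (trans c c) (coord c p) y = y.
Proof.
move=> cp; have dcc := trans_differentiable cp cp.
rewrite -deriveE// (@near_eq_derive _ _ _ _ id) ?derive_id//.
have := open_nbhs_nbhs (conj (@overlap_open _ _ M c c) _) => /(_ (coord c p)).
move=> /(_ (ex_intro2 _ _ p (conj cp cp) erefl)).
by apply: filterS => _ [q [cq _] <-]; rewrite trans_coord.
Qed.

Definition tangent_of_fun c p (y : E) : chart M -> E := fun d =>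
  if `[< dom c p /\ dom d p >] then 'd (trans c d) (coord c p) y else 0.

Lemma tangent_of_trans c p y d e : dom d p -> dom e p ->
  tangent_of_fun c p y e = 'd (trans d e) (coord d p) (tangent_of_fun c p y d).
Proof.
move=> dp ep; rewrite /tangent_of_fun.
have [cp|ncp] := pselect (dom c p); last first.
  by rewrite !asboolF ?linear0// => -[].
by rewrite !asboolT// diff_transK.
Qed.

Lemma tangent_of_out c p y d : ~ dom d p -> tangent_of_fun c p y d = 0.
Proof. by move=> ndp; rewrite /tangent_of_fun asboolF// => -[]. Qed.

(* The tangent vector at p represented by y in the chart c. *)
Definition tangent_of c p (y : E) : tangent p :=
  Tangent (@tangent_of_trans c p y) (@tangent_of_out c p y).

Definition TM : Type := {p : M & tangent p}.

(* Natural charts of R x TM: (t, v) |-> (t, x, y), where x is the coordinate of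
   the base point of v and y represents v. *)
Definition RTM_dom c : set (R * TM) := fun u => dom c (projT1 u.2).

Definition RTM_coord c (u : R * TM) : R * E * E :=
  (u.1, coord c (projT1 u.2), tcoord (projT2 u.2) c).

Definition RTM_pt c (q : R * E * E) : R * TM :=
  (q.1.1, existT _ (pt c q.1.2) (tangent_of c (pt c q.1.2) q.2)).

Lemma RTM_cover (u : R * TM) : exists c, RTM_dom c u.
Proof. exact: dom_cover. Qed.

Lemma RTM_coordK c u : RTM_dom c u -> RTM_pt c (RTM_coord c u) = u.
Proof.
case: u => t [p v]; rewrite /RTM_dom /RTM_pt /= => cp; congr (_, _).
rewrite coordK//; congr existT; apply: tangent_eq; apply/funext => d /=.
rewrite /tangent_of_fun; have [dp|ndp] := pselect (dom d p).
  by rewrite asboolT// -tcoord_trans.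
by rewrite asboolF ?tcoord_out// => -[].
Qed.

Lemma RTM_overlap_open c d :
  open (RTM_coord c @` (RTM_dom c `&` RTM_dom d)).
Proof.
rewrite (_ : _ @` _ =
    (fun q : R * E * E => q.1.2) @^-1` (coord c @` (dom c `&` dom d))).
  apply: open_comp; last exact: overlap_open.
  by move=> q _; apply: continuous_comp; [exact: cvg_fst|exact: cvg_snd].
apply/seteqP; split=> [_ [[t [p v]] [cp dp] <-]|[[t x] y] [p [cp dp] /= px]].
  by exists p.
exists (t, existT _ p (tangent_of c p y)) => //=.
by rewrite /RTM_coord/= px /tangent_of_fun asboolT// diff_trans_id.
Qed.

Definition RTM : charted (R * E * E)%type :=
  Charted RTM_cover RTM_coordK RTM_overlap_open.

End tangent_bundle.

(* Differential forms on open sets of V; the exterior derivative is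
   d theta(X, Y) = X theta(Y) - Y theta(X) - theta([X, Y]) for constant X, Y. *)
Section forms.
Context {R : realType} {V : normedModType R}.

Definition form1 := V -> V -> R.
Definition form2 := V -> V -> V -> R.

Definition dfun (f : V -> R) : form1 := fun q v => 'd f q v.

Definition dform (th : form1) : form2 := fun q v w =>
  'd (fun q' => th q' w) q v - 'd (fun q' => th q' v) q w.

Definition wedge (a b : form1) : form2 := fun q v w =>
  a q v * b q w - a q w * b q v.

End forms.

(* Local expressions in a natural chart, for a function l(t, x, y) on an open
   subset of R x E x E. *)
Section local_lagrangian.
Context {R : realType} {E : completeNormedModType R}.
Local Notation Q := (R * E * E)%type.

Definition liouville (q : Q) : Q := (0, 0, q.2).

Definition tangent_structure (v : Q) : Q := (0, 0, v.1.2).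

Definition dt : form1 (V := Q) := fun _ v => v.1.1.

Definition energy (l : Q -> R) : Q -> R := fun q => dfun l q (liouville q) - l q.

Definition theta (l : Q -> R) : form1 := fun q v => dfun l q (tangent_structure v).

Definition omega (l : Q -> R) : form2 := fun q v w => - dform (theta l) q v w.

Definition Omega (l : Q -> R) : form2 := fun q v w =>
  omega l q v w + wedge (dfun (energy l)) dt q v w.

Definition partial2 (l : Q -> R) (t : R) (x y : E) : clin E R :=
  Dop (fun x' => l (t, x', y)) x.

Definition partial3 (l : Q -> R) (t : R) (x y : E) : clin E R :=
  Dop (fun y' => l (t, x, y')) y.

Definition partial33 (l : Q -> R) (t : R) (x y : E) : clin E (clin E R) :=
  Dop (fun y' => partial3 l t x y') y.

End local_lagrangian.

Section lagrangian.
Context {R : realType} {E : completeNormedModType R} {M : manifold E}.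
Implicit Types (L : RTM M -> R) (Z : vector_field (RTM M)).

Definition regular L : Prop := forall (c : chart (RTM M)) t x y,
  cod c (t, x, y) -> is_toplinear_iso (partial33 (fun_loc L c) t x y).

(* The coefficient G of (t, x, y) |-> (1, y, - G(t, x, y)). *)
Definition spray_coef Z (c : chart (RTM M)) (q : R * E * E) : E :=
  - (vf_loc Z c q).2.

Definition semispray Z : Prop := forall (c : chart (RTM M)) q,
  cod c q -> vf_loc Z c q = (1, q.2, - spray_coef Z c q).

(* i_Z dt = 1 *)
Definition unit_time Z : Prop := forall (c : chart (RTM M)) q,
  cod c q -> dt q (vf_loc Z c q) = 1.

(* i_Z Omega_L = 0 *)
Definition in_kernel_Omega L Z : Prop := forall (c : chart (RTM M)) q,
  cod c q -> forall w, Omega (fun_loc L c) q (vf_loc Z c q) w = 0.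

Definition geodesic Z (I : set R) (g : R -> M) : Prop :=
  forall (c : chart M) s, I s -> dom c (g s) ->
  let x := coord c \o g in
  derive1 (derive1 x) s + spray_coef Z c (s, x s, derive1 x s) = 0.

(* (d/ds) d_3 L (s, x, x') = d_2 L (s, x, x') as an equation in the dual
   E^* = clin E R, the derivative being taken in the operator norm. *)
Definition euler_lagrange L (I : set R) (g : R -> M) : Prop :=
  forall (c : chart M) s, I s -> dom c (g s) ->
  let x := coord c \o g in
  is_derive s 1 (fun r => partial3 (fun_loc L c) r (x r) (derive1 x r))
    (partial2 (fun_loc L c) s (x s) (derive1 x s)).

End lagrangian.

(* Main.v *)
From HB Require Import structures.
Require Import Defs.
From mathcomp Require Import all_boot all_order all_algebra.
From mathcomp Require Import all_classical all_reals all_analysis.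
From mathcomp Require Import ring lra.
Set Implicit Arguments. Unset Strict Implicit. Unset Printing Implicit Defensive.
Import Order.TTheory GRing.Theory Num.Theory.
Import numFieldNormedType.Exports.
Local Open Scope classical_set_scope.
Local Open Scope ring_scope.

(** In a natural chart put e(V)(xi) = D^2 L (1, y, V)(0, 0, xi) - DL (0, xi, 0).
    Contracting Omega_L with (1, y, V) and w = (s, xi, eta) gives
    s e(V)(y) - e(V)(xi), so that i_Z Omega_L = 0 means e(V) = 0. This is an
    equation d_3^2 L V = a in E^*, which has exactly one solution by regularity,
    and this solution depends smoothly on the point. Under a change of chart with
    transition map phi, e(V)(xi) becomes e(W)(D phi xi) with W the transform of
    V, up to a term DL (0, 0, D^2 phi (y, xi) - D^2 phi (xi, y)) that vanishes by
    symmetry of D^2 phi; hence the local solutions define a global vector field.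
    Along a curve x, e(x'') is the difference between the two sides of the
    Euler-Lagrange equation. *)

(** * Bounded operators *)

Section bounded_operators.
Context {R : realType}.
Implicit Types V W X Y Z : normedModType R.

Let ler_mul2l (x y z : R) : 0 <= x -> y <= z -> x * y <= x * z.
Proof. by move=> x0 yz; rewrite ler_wpM2l. Qed.

Let ler_mul2r (x y z : R) : 0 <= x -> y <= z -> y * x <= z * x.
Proof. by move=> x0 yz; rewrite ler_wpM2r. Qed.

Lemma clin_normP V W (f : clin V W) x : `|f x| <= `|f| * `|x|.
Proof.
have [->|x0] := eqVneq x 0; first by rewrite linear0 !normr0 mulr0.
have xgt0 : 0 < `|x| by rewrite normr_gt0.
have : `|f (`|x|^-1 *: x)| <= `|f|.
  by apply: op_norm_ub; rewrite normrZV ?unitfE ?normr_eq0.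
by rewrite linearZ normrZ normfV normr_id ler_pdivrMl// mulrC.
Qed.

Lemma clin_norm_le V W (f : clin V W) (k : R) : 0 <= k ->
  (forall x, `|f x| <= k * `|x|) -> `|f| <= k.
Proof.
move=> k0 fk; apply: op_norm_le => x x1.
by rewrite (le_trans (fk x))// ler_piMr.
Qed.

Lemma clinP V W (f g : clin V W) : f =1 g -> f = g.
Proof. by move=> fg; apply: val_inj; apply/funext. Qed.

Lemma clin_addE V W (f g : clin V W) x : (f + g) x = f x + g x.
Proof. by []. Qed.

(** The bound maps every ball into a bounded set, which for a linear map is continuity. The sign of
    [k] is free, so the radii are multiplied by [|k|]. *)
Lemma bounded_clin_in V W (f : V -> W) (lf : linear f) (k : R) :
  (forall x, `|f x| <= k * `|x|) -> f \in @clin_pred R V W.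
Proof.
move=> fk; apply/asboolP; split => //.
pose fM := GRing.isLinear.Build _ _ _ _ _ lf.
pose fL : {linear _ -> _} := HB.pack f fM.
apply/(@linear_bounded_continuous _ _ _ fL)/bounded_funP => r.
exists (`|k| * r) => x xr; rewrite (le_trans (fk x))//.
rewrite (le_trans (ler_wpM2r _ (ler_norm k)))//.
by rewrite ler_wpM2l.
Qed.

Definition mkclin V W (f : V -> W) (lf : linear f) (k : R)
  (fk : forall x, `|f x| <= k * `|x|) : clin V W :=
  Clin (bounded_clin_in lf fk).

Section bilinear.
Variables (X Y Z : normedModType R) (f : X -> Y -> Z) (k : R).
Hypotheses (k0 : 0 <= k) (lin1 : forall y, linear (f^~ y))
  (lin2 : forall x, linear (f x))
  (fk : forall x y, `|f x y| <= k * `|x| * `|y|).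

Let part x : clin Y Z := mkclin (lin2 x) (fk x).

Fact mkbilin_linear : linear part.
Proof. by move=> a x y; apply: clinP => z; exact: lin1. Qed.

Fact mkbilin_bound x : `|part x| <= k * `|x|.
Proof. by apply: clin_norm_le => [|y]; [exact: mulr_ge0|exact: fk]. Qed.

Definition mkbilin : clin X (clin Y Z) := mkclin mkbilin_linear mkbilin_bound.

End bilinear.

Lemma bilinBl X Y Z (b : clin X (clin Y Z)) x x' y :
  b (x - x') y = b x y - b x' y.
Proof. by rewrite linearB. Qed.

Lemma bilinBB X Y Z (b : clin X (clin Y Z)) x x' y y' :
  b (x - x') (y - y') = b x y - b x y' - (b x' y - b x' y').
Proof. by rewrite bilinBl !linearB. Qed.

(** This operator and those below are closed by [Defined], so that their values are convertible to
    the underlying formulas. Read as a bilinear map, the identity of [clin X Y] is the pairing (f,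
    x) |-> f x. *)
Definition clin_id V : clin V V.
Proof. by apply: (@mkclin V V id _ 1) => // x; rewrite mul1r. Defined.

Definition clin_comp X Y Z (g : clin Y Z) (f : clin X Y) : clin X Z.
Proof.
apply: (@mkclin X Z (g \o f) _ (`|g| * `|f|)) => [a x y|x].
  by rewrite /= linearP linearP.
rewrite (le_trans (clin_normP _ _))// -mulrA.
by apply: ler_mul2l => //; exact: clin_normP.
Defined.

Lemma clin_compE X Y Z (g : clin Y Z) (f : clin X Y) x :
  clin_comp g f x = g (f x).
Proof. by []. Qed.

(** In particular [clin_flip (clin_id (clin X Y)) x] is evaluation at [x], a bounded operator on
    [clin X Y]. *)
Definition clin_flip X Y Z (b : clin X (clin Y Z)) : clin Y (clin X Z).
Proof.
apply: (@mkbilin Y X Z (fun y x => b x y) `|b|) => // [x a y z|y a x z|y x].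
- exact: linearP.
- by rewrite linearP.
- rewrite (le_trans (clin_normP _ _))// -mulrA [`|y| * _]mulrC mulrA.
  by apply: ler_mul2r => //; exact: clin_normP.
Defined.

(** Composition is itself a bounded bilinear map; derivatives of composites and products thus become
    values of bounded operators, to which the same calculus applies again. *)
Definition clin_compb X Y Z : clin (clin Y Z) (clin (clin X Y) (clin X Z)).
Proof.
apply: (@mkbilin _ _ _ (@clin_comp X Y Z) 1) => // [f a g h|g a f h|g f].
- by apply: clinP.
- by apply: clinP => x /=; rewrite linearP.
- rewrite mul1r; apply: clin_norm_le => [|x]; first exact: mulr_ge0.
  rewrite (le_trans (clin_normP g (f x)))// -mulrA.
  by apply: ler_mul2l => //; exact: clin_normP.
Defined.

Definition clin_precomp X Y Z (f : clin X Y) : clin (clin Y Z) (clin X Z) :=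
  clin_flip (clin_compb X Y Z) f.

Definition clin_fst X Y : clin (X * Y)%type X.
Proof.
apply: (@mkclin _ _ (@fst X Y) _ 1) => // x.
by rewrite mul1r prod_normE num_le_max lexx.
Defined.

Definition clin_snd X Y : clin (X * Y)%type Y.
Proof.
apply: (@mkclin _ _ (@snd X Y) _ 1) => // x.
by rewrite mul1r prod_normE num_le_max lexx orbT.
Defined.

Definition clin_inl X Y : clin X (X * Y)%type.
Proof.
apply: (@mkclin X (X * Y)%type (fun x => (x, 0)) _ 1) => [a x y|x].
  by rewrite -[RHS]/(a *: x + y, a *: 0 + 0) scaler0 addr0.
by rewrite mul1r prod_normE num_ge_max /= normr0 lexx normr_ge0.
Defined.

Definition clin_inr X Y : clin Y (X * Y)%type.
Proof.
apply: (@mkclin Y (X * Y)%type (fun y => (0, y)) _ 1) => [a x y|x].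
  by rewrite -[RHS]/(a *: 0 + 0, a *: x + y) scaler0 addr0.
by rewrite mul1r prod_normE num_ge_max /= normr0 lexx normr_ge0.
Defined.

End bounded_operators.

(** * Differential calculus *)

Section calculus.
Context {R : realType}.
Implicit Types V W X Y Z : normedModType R.

Lemma Dop_val V W (f : V -> W) x (A : clin V W) : is_diff x f A -> Dop f x = A.
Proof.
move=> dfA; apply: clinP => v; rewrite DopE; last exact: ex_diff.
by rewrite diff_val.
Qed.

Lemma Dop_is_diff V W (f : V -> W) x :
  differentiable f x -> is_diff x f (Dop f x).
Proof. by move=> df; apply: DiffDef => //; rewrite DopE. Qed.

Lemma is_diff_clin V W (A : clin V W) x : is_diff x A A.
Proof.
apply: DiffDef; first exact/linear_differentiable/clin_continuous.
by rewrite diff_lin //; exact: clin_continuous.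
Qed.

(** The estimate is the little-o expansion of [f] at [x], translated to 0, and the continuous linear
    part of such an expansion is unique. *)
Lemma is_diff_epsP V W (f : V -> W) x (A : clin V W) :
  (forall e : R, 0 < e ->
    \forall y \near x, `|f y - f x - A (y - x)| <= e * `|y - x|) ->
  is_diff x f A.
Proof.
move=> H.
have E : f \o shift x = cst (f x) + A +o_ 0 id.
  apply/eqaddoP => e e0; have := H _ e0; rewrite (near_shift 0) subr0.
  apply: filterS => h /=.
  by rewrite addrK opprD addrA.
have dA : 'd f x = A :> (V -> W).
  by apply: diff_unique => //; exact: clin_continuous.
apply: DiffDef => //; apply/diff_locallyP; rewrite dA; split => //.
exact: clin_continuous.
Qed.

Lemma is_diff_eps V W (f : V -> W) x (A : clin V W) (e : R) :
  is_diff x f A -> 0 < e ->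
  \forall y \near x, `|f y - f x - A (y - x)| <= e * `|y - x|.
Proof.
move=> [/diff_locallyP[_ E] dA] e0; rewrite dA in E.
move/eqaddoP: E => /(_ e e0); rewrite [X in _ -> X](near_shift 0) subr0.
by apply: filterS => h /=; rewrite addrK opprD addrA.
Qed.

Lemma near_is_diff V W (f g : V -> W) x (A : clin V W) :
  {near x, f =1 g} -> is_diff x f A -> is_diff x g A.
Proof.
move=> fg dfA; apply: is_diff_epsP => e e0; have := is_diff_eps dfA e0.
have fgx := nbhs_singleton fg.
by apply: filterS2 fg => y <-; rewrite fgx.
Qed.

Lemma near_Dop V W (f g : V -> W) x :
  {near x, f =1 g} -> differentiable f x -> Dop f x = Dop g x.
Proof.
by move=> fg /Dop_is_diff df; apply/esym/Dop_val; exact: near_is_diff df.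
Qed.

Lemma is_diff_clinD V W (f g : V -> W) x (A B : clin V W) :
  is_diff x f A -> is_diff x g B -> is_diff x (fun y => f y + g y) (A + B).
Proof. by move=> df dg; exact: is_diffD. Qed.

Lemma is_diff_clin_ext V W (f g : V -> W) x (A B : clin V W) :
  is_diff x f A -> f =1 g -> A =1 B -> is_diff x g B.
Proof. by move=> df /funext <- /clinP <-. Qed.

Lemma is_diff_clin_cst V W (a : W) (x : V) :
  is_diff x (fun _ => a) (0 : clin V W).
Proof. exact: is_diff_cst. Qed.

Lemma is_diff_clinDc V W (f : V -> W) (a : W) x (A : clin V W) :
  is_diff x f A -> is_diff x (fun y => f y + a) A.
Proof.
move=> df; have := is_diff_clinD df (is_diff_clin_cst a x).
by rewrite addr0.
Qed.

Lemma is_diff_clin_comp X Y Z (f : X -> Y) (g : Y -> Z) x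
    (A : clin X Y) (B : clin Y Z) :
  is_diff x f A -> is_diff (f x) g B ->
  is_diff x (fun y => g (f y)) (clin_comp B A).
Proof. by move=> df dg; exact: is_diff_comp. Qed.

(** The remainder is exactly [b (q.1 - p.1) (q.2 - p.2)], hence at most [|b|] times the square of
    [|q - p|]. *)
Lemma is_diff_bilin_pair X Y Z (b : clin X (clin Y Z)) (p : X * Y) :
  is_diff p (fun q => b q.1 q.2)
    (clin_comp (clin_flip b p.2) (clin_fst X Y) +
     clin_comp (b p.1) (clin_snd X Y)).
Proof.
apply: is_diff_epsP => e e0.
(* The summand 1 keeps the denominator positive when [b] is 0. *)
have d0 : 0 < e / (`|b| + 1) by rewrite divr_gt0// ltr_wpDl.
have : \forall q \near p, `|q - p| < e / (`|b| + 1).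
  by apply/nbhs_ballP; exists (e / (`|b| + 1)) => //= q;
    rewrite -ball_normE /= distrC.
apply: filterS => q /ltW qp.
rewrite (_ : _ - _ = b (q.1 - p.1) (q.2 - p.2)); last first.
  rewrite [RHS](bilinBB b q.1 p.1 q.2 p.2).
  rewrite clin_addE /= bilinBl linearB /= opprD !opprB addrA addrAC.
  by rewrite subrKA [X in _ + X = _]addrC addrACA [X in _ + X = _]addrC.
have q1 : `|q.1 - p.1| <= `|q - p| by rewrite prod_normE num_le_max lexx.
have q2 : `|q.2 - p.2| <= `|q - p| by rewrite prod_normE num_le_max lexx orbT.
rewrite (le_trans (clin_normP _ _))//; apply: ler_pM => //.
rewrite (le_trans (clin_normP _ _))//.
have b1 : 0 < `|b| + 1 by rewrite ltr_wpDl.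
have bq := ler_pM (normr_ge0 b) (normr_ge0 _) (lexx `|b|) (le_trans q1 qp).
rewrite (le_trans bq)// mulrCA.
apply: ler_piMr; first exact: ltW.
by rewrite ler_pdivrMr// mul1r lerDl.
Qed.

Lemma is_diff_bilin V X Y Z (b : clin X (clin Y Z)) (f : V -> X) (g : V -> Y) x
    (A : clin V X) (B : clin V Y) :
  is_diff x f A -> is_diff x g B ->
  is_diff x (fun y => b (f y) (g y))
    (clin_comp (clin_flip b (g x)) A + clin_comp (b (f x)) B).
Proof.
move=> df dg; have dfg := is_diff_pair df dg.
have db := is_diff_bilin_pair b (f x, g x).
exact: is_diff_eq (is_diff_comp dfg db) _.
Qed.

(* As f vanishes at x, the second factor need not be differentiable there. *)
Lemma is_diff_vanish V X Y Z (b : clin X (clin Y Z)) (f : V -> X) (u : V -> Y)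
    x (A : clin V X) :
  is_diff x f A -> f x = 0 -> {for x, continuous u} ->
  is_diff x (fun y => b (f y) (u y)) (clin_comp (clin_flip b (u x)) A).
Proof.
move=> dfA fx0 cu.
have dfu : is_diff x (fun y => b (f y) (u x)) (clin_comp (clin_flip b (u x)) A).
  exact: (is_diff_clin_comp dfA (is_diff_clin (clin_flip b (u x)) _)).
apply: is_diff_epsP => e e0.
have e2 : 0 < e / 2 by rewrite divr_gt0.
pose k := `|b| * (`|A| + 1) + 1.
have k0 : 0 < k by rewrite ltr_wpDl// mulr_ge0// addr_ge0.
have ek : 0 < e / 2 / k by rewrite divr_gt0.
have : \forall y \near x, `|u x - u y| < e / 2 / k by apply: cvgr_dist_lt.
apply: filterS3 (is_diff_eps dfu e2) (is_diff_eps dfA ltr01) => y H1 H2 H3.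
have fy : `|f y| <= (`|A| + 1) * `|y - x|.
  rewrite fx0 subr0 in H2.
  rewrite -[f y](subrK (A (y - x))) (le_trans (ler_normD _ _))// mulrDl addrC.
  by rewrite lerD// clin_normP.
have H4 : `|b (f y) (u y - u x)| <= e / 2 * `|y - x|.
  rewrite (le_trans (clin_normP _ _))//.
  have bfy : `|b (f y)| <= `|b| * ((`|A| + 1) * `|y - x|).
    rewrite (le_trans (clin_normP _ _))//; exact: ler_pM.
  have uyx : `|u y - u x| <= e / 2 / k by rewrite distrC ltW.
  rewrite (le_trans (ler_pM (normr_ge0 _) (normr_ge0 _) bfy uyx))//.
  rewrite mulrA mulrAC; apply: ler_wpM2r => //.
  rewrite mulrCA; apply: ler_piMr; first exact: ltW.
  by rewrite ler_pdivrMr// mul1r lerDl.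
(* Freezing the second factor at [u x] leaves [b (f y) (u y - u x)], the product of a factor of
   order [|y - x|] and one that tends to 0. *)
rewrite (_ : _ - _ - _ = (b (f y) (u x) - b (f x) (u x) -
  clin_comp (clin_flip b (u x)) A (y - x)) + b (f y) (u y - u x)).
  rewrite (le_trans (ler_normD _ _))// [e in e * _]splitr mulrDl.
  exact: lerD.
by rewrite (linearB (b (f y)) (u y)) /= [RHS]addrC !addrA subrK.
Qed.

End calculus.

(** * Maps of class C^n, and linear equations with invertible operator coefficients *)

Section smooth_maps.
Context {R : realType}.
Implicit Types V W X Y Z : normedModType R.

Lemma eq_on_near V W (U : set V) (f g : V -> W) x : open U ->
  (forall y, U y -> f y = g y) -> U x -> {near x, f =1 g}.
Proof.
move=> oU fg Ux; have := open_nbhs_nbhs (conj oU Ux).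
by apply: filterS => y; exact: fg.
Qed.

(** On an open set, equality on [U] is equality near each point of [U], so the derivatives agree on
    [U] as well and the induction continues. *)
Lemma eq_Ck_on n V W (U : set V) (f g : V -> W) : open U ->
  (forall x, U x -> f x = g x) -> Ck_on n U f -> Ck_on n U g.
Proof.
move=> oU; elim: n W f g => [|n IH] W f g fg /=.
  move=> cf x Ux; have fgx := eq_on_near oU fg Ux.
  rewrite /prop_for /continuous_at -(fg _ Ux).
  by apply: cvg_trans (cf x Ux); exact: near_eq_cvg.
move=> [df cf]; split=> [x Ux|].
  have /Dop_is_diff dfx := df x Ux.
  by have [] := near_is_diff (eq_on_near oU fg Ux) dfx.
apply: IH cf => x Ux; apply: near_Dop; last exact: df.
exact: eq_on_near Ux.
Qed.

Lemma Ck_onW n V W (U : set V) (f : V -> W) : Ck_on n.+1 U f -> Ck_on n U f.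
Proof.
elim: n W f => [|n IH] W f /= [df cf].
  by move=> x Ux; exact/differentiable_continuous/df.
by split => //; exact: IH.
Qed.

(** Allows the derivative to be given by a formula that is valid on [U] only. *)
Lemma Ck_on_diff n V W (U : set V) (f : V -> W) (Df : V -> clin V W) : open U ->
  (forall x, U x -> is_diff x f (Df x)) -> Ck_on n U Df -> Ck_on n.+1 U f.
Proof.
move=> oU df cDf; split=> [x Ux|]; first by have [] := df x Ux.
by apply: eq_Ck_on cDf => // x Ux; exact/esym/Dop_val/df.
Qed.

Lemma Ck_on_cst n V W (U : set V) (a : W) : open U -> Ck_on n U (fun _ => a).
Proof.
move=> oU; elim: n W a => [|n IH] W a /=; first by move=> x _; exact: cvg_cst.
by apply: (@Ck_on_diff _ _ _ _ _ (fun _ => 0)).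
Qed.

Lemma Ck_on_clin n V W (U : set V) (A : clin V W) : open U -> Ck_on n U A.
Proof.
case: n => [|n] oU; first by move=> x _; exact: clin_continuous.
apply: (@Ck_on_diff _ _ _ _ _ (fun _ => A)) => [//|x _|].
  exact: is_diff_clin.
exact: Ck_on_cst.
Qed.

Lemma Ck_onD n V W (U : set V) (f g : V -> W) : open U ->
  Ck_on n U f -> Ck_on n U g -> Ck_on n U (fun x => f x + g x).
Proof.
move=> oU; elim: n W f g => [|n IH] W f g /=.
  by move=> cf cg x Ux; apply: cvgD; [exact: cf|exact: cg].
move=> [df cf] [dg cg].
pose D x : clin V W := Dop f x + Dop g x.
refine (@Ck_on_diff n V W U _ D oU _ _) => [x Ux|].
  by apply: is_diff_clinD; apply: Dop_is_diff; [exact: df|exact: dg].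
exact: IH.
Qed.

(** The derivative is the bounded operator [clin_compb V X Y A] applied to [Dop f], a map of the
    same shape; hence the induction over all [X], [Y] and [A]. *)
Lemma Ck_on_post n V X Y (U : set V) (A : clin X Y) (f : V -> X) : open U ->
  Ck_on n U f -> Ck_on n U (fun x => A (f x)).
Proof.
move=> oU; elim: n X Y A f => [|n IH] X Y A f /=.
  move=> cf x Ux; apply: continuous_comp; first exact: cf.
  exact: clin_continuous.
move=> [df cf].
apply: (@Ck_on_diff _ _ _ _ _ (fun x => clin_compb V X Y A (Dop f x)))
  => [//|x Ux|].
  apply: is_diff_clin_comp; first exact/Dop_is_diff/df.
  exact: is_diff_clin.
exact: IH.
Qed.

(** The product rule gives two terms, each again a bounded bilinear map of one function and one
    derivative; hence the induction over all spaces and all [b]. *)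
Lemma Ck_on_bilin n V X Y Z (U : set V) (b : clin X (clin Y Z))
    (f : V -> X) (g : V -> Y) : open U ->
  Ck_on n U f -> Ck_on n U g -> Ck_on n U (fun x => b (f x) (g x)).
Proof.
move=> oU; elim: n X Y Z b f g => [|n IH] X Y Z b f g.
  move=> cf cg x Ux.
  apply: (@continuous_comp _ _ _ (fun x => (f x, g x)) (fun q => b q.1 q.2)).
    by apply: cvg_pair; [exact: cf|exact: cg].
  apply: differentiable_continuous.
  by have [] := is_diff_bilin_pair b (f x, g x).
move=> Cf Cg; have [[df cf] [dg cg]] := (Cf, Cg).
pose D x : clin V Z :=
  clin_comp (clin_compb V X Z) (clin_flip b) (g x) (Dop f x) +
  clin_comp (clin_compb V Y Z) b (f x) (Dop g x).
refine (@Ck_on_diff n V Z U _ D oU _ _) => [x Ux|].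
  by apply: is_diff_bilin; apply: Dop_is_diff; [exact: df|exact: dg].
by apply: Ck_onD => //; apply: IH => //; exact: Ck_onW.
Qed.

(** With B inverse to [A x], |w| is at most |B| |A x w|. Replacing [A x] by a nearby [A y] costs at
    most half of |w|, which is absorbed on the left; the factor 2 in [k] is chosen for this. *)
Lemma iso_near_bound X Y (V : topologicalType) (x : V) (A : V -> clin X Y) :
  is_toplinear_iso (A x) -> {for x, continuous A} ->
  exists2 k : R, 0 < k & \forall y \near x, forall w, `|w| <= k * `|A y w|.
Proof.
move=> [B [AB BA]] cA; pose k := 2 * (`|B| + 1).
have B0 : 0 < `|B| + 1 by rewrite ltr_wpDl.
have k0 : 0 < k by rewrite mulr_gt0.
exists k => //.
have : \forall y \near x, `|A x - A y| < k^-1.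
  by apply: cvgr_dist_lt; rewrite // invr_gt0.
apply: filterS => y Ay w.
have wAw : `|w| <= `|B| * (`|A y w| + `|A x - A y| * `|w|).
  rewrite -{1}[w]AB (le_trans (clin_normP _ _))//; apply: ler_pM => //.
  rewrite -[A x w](subrK (A y w)) addrC (le_trans (ler_normD _ _))// lerD2l.
  exact: (clin_normP (A x - A y)).
have : `|w| <= (`|B| + 1) * (`|A y w| + k^-1 * `|w|).
  rewrite (le_trans wAw)//; apply: ler_pM => //.
  - by rewrite lerDl.
  - by rewrite lerD2l; apply: ler_wpM2r => //; exact: ltW.
rewrite mulrDr mulrA.
rewrite (_ : (`|B| + 1) * k^-1 = 2^-1); last first.
  by rewrite /k invfM mulrCA mulfV ?mulr1// gt_eqF.
rewrite -lerBlDr {1}[`|w|]splitr [2^-1 * _]mulrC addrK ler_pdivrMr//.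
by rewrite mulrAC /k [2 * _]mulrC.
Qed.

(** By the lower bound for [A y], the distance from [u x] to [u y] is at most k times the norm of A
    y (u x) - a y, which is continuous in y at [x] and vanishes there. *)
Lemma solve_continuous V X Y (A : V -> clin X Y) (a : V -> Y) (u : V -> X) x :
  is_toplinear_iso (A x) -> {for x, continuous A} -> {for x, continuous a} ->
  {near x, (fun y => A y (u y)) =1 a} -> {for x, continuous u}.
Proof.
move=> isoA cA ca uE.
have [k k0 Ak] := iso_near_bound isoA cA.
apply/cvgrPdist_lt => e e0.
have c : {for x, continuous (fun y => A y (u x))}.
  apply: (@continuous_comp _ _ _ A (fun T : clin X Y => T (u x))) => //.
  exact: (@clin_continuous _ _ _ (clin_flip (clin_id (clin X Y)) (u x))).
have : \forall y \near x, `|(a x - A x (u x)) - (a y - A y (u x))| < e / k.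
  have ek : 0 < e / k by rewrite divr_gt0.
  (* Generalising [e / k] to an arbitrary positive number turns the goal into a convergence
     statement. *)
  by move: e {e0} (e / k) ek => _; apply/cvgrPdist_lt; apply: cvgB.
have uEx := nbhs_singleton uE.
apply: filterS3 Ak uE => y /(_ (u x - u y)) H uy.
rewrite -uy -uEx subrr sub0r opprB -linearB => H2.
rewrite (le_lt_trans H)// -ltr_pdivlMl// mulrC.
exact: H2.
Qed.

(** Near [x], A x (u y) = a y - (A y - A x)(u y). As A y - A x vanishes at [x], continuity of [u]
    suffices to differentiate the right-hand side; applying [B] then gives [u]. *)
Lemma solve_is_diff V X Y (A : V -> clin X Y) (a : V -> Y) (u : V -> X) x
    (B : clin Y X) (DA : clin V (clin X Y)) (Da : clin V Y) :
  cancel (A x) B -> cancel B (A x) -> is_diff x A DA -> is_diff x a Da ->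
  {near x, (fun y => A y (u y)) =1 a} ->
  is_diff x u (clin_comp B (Da - clin_flip DA (u x))).
Proof.
move=> AB BA dA da uE.
have cu : {for x, continuous u}.
  apply: solve_continuous uE.
  - by exists B.
  - by apply: differentiable_continuous; have [] := dA.
  - by apply: differentiable_continuous; have [] := da.
have dAx : is_diff x (fun y => A y - A x) DA := is_diff_clinDc _ dA.
have dv := is_diff_vanish (clin_id (clin X Y)) dAx (subrr _) cu.
have dw := is_diff_clinD da
  (is_diff_clin_comp dv (is_diff_clin (- clin_id Y) _)).
have dz := is_diff_clin_comp dw (is_diff_clin B _).
rewrite (_ : clin_comp B _ = clin_comp B (Da + clin_comp (- clin_id Y)
  (clin_comp (clin_flip (clin_id (clin X Y)) (u x)) DA))); last first.
  exact: clinP.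
apply: near_is_diff dz; apply: filterS uE => y uy /=.
rewrite -uy.
have E : A y (u y) - (A y (u y) - A x (u y)) = A x (u y).
  by rewrite opprB addrC subrK.
by rewrite -[RHS]AB -[in RHS]E.
Qed.

Lemma clin_compb_iso V X Y (A : clin X Y) :
  is_toplinear_iso A -> is_toplinear_iso (clin_compb V X Y A).
Proof.
move=> [B [AB BA]]; exists (clin_compb V Y X B).
by split => f; apply: clinP => x /=; [exact: AB|exact: BA].
Qed.

(* By induction on n: where A u = a, the derivative Du solves the equation
   A o Du = Da - (DA) u, again with invertible coefficients, so that neither the
   completeness of X nor the smoothness of A |-> A^-1 is involved. *)
Lemma Ck_on_solve n V X Y (U : set V) (A : V -> clin X Y) (a : V -> Y)
    (u : V -> X) : open U ->
  (forall x, U x -> is_toplinear_iso (A x)) -> Ck_on n U A -> Ck_on n U a ->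
  (forall x, U x -> A x (u x) = a x) -> Ck_on n U u.
Proof.
move=> oU; elim: n X Y A a u => [|n IH] X Y A a u isoA CA Ca uE.
  move=> x Ux; apply: solve_continuous (eq_on_near oU uE Ux).
  - exact: isoA.
  - exact: CA.
  - exact: Ca.
(* The equation for the derivative of [u] contains [u] itself, so its class C^n is needed first. *)
have Cu : Ck_on n U u.
  by apply: IH isoA _ _ uE; exact: Ck_onW.
have du x : U x -> exists2 B : clin Y X, cancel B (A x) &
    is_diff x u (clin_comp B (Dop a x - clin_flip (Dop A x) (u x))).
  move=> Ux; have [B [AB BA]] := isoA x Ux; exists B => //.
  apply: solve_is_diff AB BA _ _ (eq_on_near oU uE Ux).
  - by apply: Dop_is_diff; case: CA => + _; exact.
  - by apply: Dop_is_diff; case: Ca => + _; exact.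
split=> [x Ux|]; first by have [B _ []] := du x Ux.
(* [b (u x) (Dop A x)] is v |-> DA(v)(u x), arranged as a bilinear expression in [u] and [Dop A]. *)
pose ev : clin X (clin (clin X Y) Y) := clin_flip (clin_id (clin X Y)).
pose b := clin_comp (clin_compb V (clin X Y) Y) ev.
apply: (IH _ _ (fun x => clin_compb V X Y (A x))
  (fun x => Dop a x + (- clin_id (clin V Y)) (b (u x) (Dop A x)))).
- by move=> x Ux; apply: clin_compb_iso; exact: isoA.
- by apply: Ck_on_post => //; exact: Ck_onW.
- case: CA => _ CDA; case: Ca => _ CDa.
  apply: Ck_onD => //; apply: Ck_on_post => //.
  exact: Ck_on_bilin.
- move=> x Ux; have [B BA /Dop_val ->] := du x Ux.
  by apply: clinP => v /=; rewrite BA.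
Qed.

End smooth_maps.

(** * Symmetry of the second derivative *)

Section second_derivative.
Context {R : realType}.
Implicit Types V W : normedModType R.

Definition clin_line V (v : V) : clin R V.
Proof.
apply: (@mkclin _ R V (fun s : R => s *: v) _ `|v|) => [a s t|s].
  by rewrite scalerDl scalerA.
by rewrite normrZ mulrC.
Defined.

Lemma is_diff_line V W (f : V -> W) (x v : V) (t : R) (A : clin V W) :
  is_diff (t *: v + x) f A ->
  is_diff t (fun s : R => f (s *: v + x)) (clin_comp A (clin_line v)).
Proof.
move=> df; apply: (@is_diff_clin_comp _ R V W (fun s : R => s *: v + x)) df.
exact: (is_diff_clinDc x (is_diff_clin (clin_line v) t)).
Qed.

Lemma is_diff_is_derive W (f : R -> W) t (A : clin R W) :
  is_diff t f A -> is_derive t 1 f (A 1).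
Proof.
move=> [df Adf]; apply: DeriveDef; first exact: diff_derivable.
by rewrite deriveE// Adf.
Qed.

Definition second_difference V (f : V -> R) (x v w : V) : R :=
  f (v + w + x) - f (v + x) - (f (w + x) - f x).

Lemma second_differenceC V (f : V -> R) x v w :
  second_difference f x v w = second_difference f x w v.
Proof.
by rewrite /second_difference [w + v]addrC; ring.
Qed.

Let subr_sub_cancel (Z : zmodType) (p q r a b : Z) :
  p - r - b = p - q - (a + b) - (r - q - a).
Proof.
by rewrite (opprB _ a) (opprD a b) [- a - b]addrC (addrA (p - q)) subrKA
  [RHS]addrAC opprB subrKA.
Qed.

(* Mean value theorem for s |-> f (s v + h w + x) - f (s v + x) on [0, h]. *)
Lemma second_difference_approx V (f : V -> R) (x v w : V)
    (B : clin V (clin V R)) (e : R) :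
  (\forall y \near x, differentiable f y) -> is_diff x (Dop f) B -> 0 < e ->
  \forall h \near (0 : R)^'+,
    `|second_difference f x (h *: v) (h *: w) - h ^+ 2 * B w v| <=
    h ^+ 2 * (e * (`|v| *+ 2 + `|w|) * `|v|).
Proof.
move=> df dB e0.
have := is_diff_eps dB e0 => /filterI/(_ df)/nbhs_ballP[d /= d0 Hd].
(* For h < r, all vectors of norm at most h (|v| + |w|) stay in the ball of radius [d] on which the
   expansion of [Dop f] holds. *)
pose r := d / (`|v| + `|w| + 1).
have n0 : 0 < `|v| + `|w| + 1 by rewrite ltr_wpDl// addr_ge0.
have r0 : 0 < r by rewrite divr_gt0.
near=> h.
have h0 : 0 < h by near: h; exact: nbhs_right_gt.
have hr : h < r by near: h; exact: nbhs_right_lt.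
have inball (z : V) : `|z| <= h * (`|v| + `|w|) ->
    differentiable f (z + x) /\ `|Dop f (z + x) - Dop f x - B z| <= e * `|z|.
  move=> zh; have /Hd[] : ball x d (z + x).
    rewrite -ball_normE /= distrC addrK (le_lt_trans zh)//.
    rewrite (@lt_le_trans _ _ (h * (`|v| + `|w| + 1)))//.
      by rewrite ltr_pM2l// ltrDl.
    by rewrite -ler_pdivlMr// ltW.
  by rewrite addrK.
pose A s : clin V R := Dop f (s *: v + (h *: w + x)) - Dop f (s *: v + x).
pose g s : R := f (s *: v + (h *: w + x)) - f (s *: v + x).
have sv (s : R) : 0 <= s <= h -> `|s *: v + h *: w| <= h * (`|v| + `|w|) /\
    `|s *: v| <= h * (`|v| + `|w|).
  move=> /andP[s0 sh].
  have sv : `|s *: v| <= h * `|v| by rewrite normrZ ger0_norm// ler_wpM2r.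
  split; last by rewrite (le_trans sv)// ler_pM2l// lerDl.
  by rewrite (le_trans (ler_normD _ _))// mulrDr lerD// normrZ gtr0_norm.
have dg s : 0 <= s <= h -> is_derive s 1 g (A s v).
  move=> /sv[/inball[+ _] /inball[+ _]]; rewrite -addrA => d1 d2.
  have l1 := is_diff_line (Dop_is_diff d1).
  have l2 := is_diff_line (Dop_is_diff d2).
  have := is_derive_eq
    (is_deriveB (is_diff_is_derive l1) (is_diff_is_derive l2)).
  by apply; rewrite /= scale1r.
have := @MVT R g (fun s => A s v) 0 h h0.
have -> : g h - g 0 = second_difference f x (h *: v) (h *: w).
  by rewrite /second_difference /g !scale0r !add0r addrA.
case.
- by move=> s; rewrite in_itv /= => /andP[s0 sh]; apply: dg; rewrite !ltW.
- apply: continuous_in_subspaceT => s; rewrite inE /= in_itv /= => /dg[+ _].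
  by move=> /derivable1_diffP/differentiable_continuous.
move=> s; rewrite in_itv /= subr0 => /andP[s0 sh] ->.
have /sv[/inball[_ b1] /inball[_ b2]] : 0 <= s <= h by rewrite !ltW.
have -> : A s v * h - h ^+ 2 * B w v = h * (A s v - B (h *: w) v).
  have -> : B (h *: w) v = h * B w v by rewrite linearZ.
  by ring.
rewrite normrM gtr0_norm// expr2 -mulrA ler_pM2l//.
rewrite (_ : A s v - _ = (A s - B (h *: w)) v)//.
rewrite (le_trans (clin_normP _ _))// mulrA; apply: ler_wpM2r => //.
(* A difference of two remainders of [Dop f] at [x], for the increments s v + h w and s v; their
   norms add up to at most h (2|v| + |w|). *)
rewrite (_ : A s - _ =
  (Dop f (s *: v + h *: w + x) - Dop f x - B (s *: v + h *: w)) -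
  (Dop f (s *: v + x) - Dop f x - B (s *: v))); last first.
  by rewrite /A addrA linearD; exact: subr_sub_cancel.
rewrite (le_trans (ler_normB _ _))// (le_trans (lerD b1 b2))// -mulrDr mulrCA.
apply: ler_wpM2l; first exact: ltW.
have sv1 : `|s *: v| <= h * `|v| by rewrite normrZ gtr0_norm// ler_wpM2r// ltW.
rewrite (le_trans (lerD (ler_normD _ _) (lexx _)))// normrZ [`|h *: w|]normrZ.
rewrite !gtr0_norm// mulrDr mulr2n mulrDr.
by move: sv1; rewrite normrZ gtr0_norm// => sv1; lra.
Unshelve. all: by end_near. Qed.

(** The second difference is symmetric in its two increments, while h^2 B w v and h^2 B v w both
    approximate it up to an arbitrarily small multiple of h^2; divide by h^2. *)
Lemma second_derivative_sym V (f : V -> R) (x v w : V) (B : clin V (clin V R)) :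
  (\forall y \near x, differentiable f y) -> is_diff x (Dop f) B ->
  B v w = B w v.
Proof.
move=> df dB.
(* The sum of the constants of the two approximations, plus 1 for positivity. *)
pose K := (`|v| *+ 2 + `|w|) * `|v| + (`|w| *+ 2 + `|v|) * `|w| + 1.
have K0 : 0 < K.
  by rewrite ltr_wpDl// addr_ge0// mulr_ge0// addr_ge0// mulrn_wge0.
apply/eqP; rewrite -subr_eq0 -normr_le0; apply/ler_addgt0Pl => e e0.
have eK : 0 < e / K by rewrite divr_gt0.
near (0 : R)^'+ => h.
have h0 : 0 < h by near: h; exact: nbhs_right_gt.
have H1 : `|second_difference f x (h *: v) (h *: w) - h ^+ 2 * B w v| <=
    h ^+ 2 * (e / K * (`|v| *+ 2 + `|w|) * `|v|).
  by near: h; exact: second_difference_approx.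
have H2 : `|second_difference f x (h *: w) (h *: v) - h ^+ 2 * B v w| <=
    h ^+ 2 * (e / K * (`|w| *+ 2 + `|v|) * `|w|).
  by near: h; exact: second_difference_approx.
have h2 : 0 < h ^+ 2 by rewrite exprn_gt0.
rewrite -(ler_pM2l h2) addr0.
have -> : h ^+ 2 * `|B v w - B w v| = `|h ^+ 2 * B v w - h ^+ 2 * B w v|.
  by rewrite -mulrBr normrM gtr0_norm.
rewrite second_differenceC in H2.
rewrite (le_trans (ler_distD (second_difference f x (h *: v) (h *: w)) _ _))//.
rewrite distrC in H2.
rewrite (le_trans (lerD H2 H1))// -mulrDr ler_pM2l//.
have KE : (`|w| *+ 2 + `|v|) * `|w| + (`|v| *+ 2 + `|w|) * `|v| = K - 1.
  by rewrite /K; ring.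
rewrite -!(mulrA (e / K)) -mulrDr KE mulrAC ler_pdivrMr//.
by rewrite ler_pM2l// gerBl.
Unshelve. all: by end_near. Qed.

End second_derivative.

(** * The Euler-Lagrange equation in a chart *)

Section local_euler_lagrange.
Context {R : realType} {E : completeNormedModType R}.
Local Notation Q := (R * E * E)%type.

Definition fiber_inj : clin E Q := clin_inr (R * E)%type E.

Definition base_inj : clin E Q :=
  clin_comp (clin_inl (R * E)%type E) (clin_inr R E).

Lemma fiber_injE y : fiber_inj y = (0, 0, y). Proof. by []. Qed.

Lemma base_injE y : base_inj y = (0, y, 0). Proof. by []. Qed.

Lemma pair_split (s : R) (x y : E) :
  (s, x, y) = s *: (1, 0, 0) + base_inj x + fiber_inj y :> Q.
Proof.
rewrite base_injE fiber_injE.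
rewrite -[RHS]/(s *: 1 + 0 + 0, s *: (0 : E) + x + 0, s *: (0 : E) + 0 + y).
by rewrite !scaler0 !addr0 !add0r [_ *: _]mulr1.
Qed.

(* The Euler-Lagrange expression of l along (1, y, V), tested on xi. *)
Definition el_form (l : Q -> R) (q : Q) (V xi : E) : R :=
  Dop (Dop l) q (1, q.2, V) (fiber_inj xi) - Dop l q (base_inj xi).

(** Twice differentiability at the point [q]; the condition near [q] makes ['d l] agree there with
    [Dop l], which can then be differentiated at [q]. *)
Definition C2_at (l : Q -> R) (q : Q) : Prop :=
  (\forall p \near q, differentiable l p) /\ differentiable (Dop l) q.

Section at_point.
Variables (l : Q -> R) (q : Q).
Hypothesis C2l : C2_at l q.

Lemma is_diff_dfun (a : Q) :
  is_diff q (fun p => 'd l p a) (clin_flip (Dop (Dop l) q) a).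
Proof.
have [dl ddl] := C2l.
have := is_diff_clin_comp (Dop_is_diff ddl)
  (is_diff_clin (clin_flip (clin_id (clin Q R)) a) _).
by apply: near_is_diff; apply: filterS dl => p dp /=; rewrite DopE.
Qed.

(** The Liouville field is the bounded linear map [g], so Γl is the pairing of [Dop l] with a linear
    map and the product rule applies. *)
Lemma is_diff_energy :
  is_diff q (energy l) (clin_comp (Dop l q) (clin_comp fiber_inj (clin_snd _ _))
    + clin_flip (Dop (Dop l) q) (fiber_inj q.2) - Dop l q).
Proof.
have [dl ddl] := C2l.
have dlq : differentiable l q := nbhs_singleton dl.
pose g : clin Q Q := clin_comp fiber_inj (clin_snd _ _).
have d1 := is_diff_bilin (clin_id (clin Q R)) (Dop_is_diff ddl)
  (is_diff_clin g q).
have d2 := is_diff_clin_comp (Dop_is_diff dlq) (is_diff_clin (- clin_id R) _).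
have := is_diff_clinD d1 d2.
rewrite (_ : _ + _ = clin_comp (Dop l q) g +
    clin_flip (Dop (Dop l) q) (fiber_inj q.2) - Dop l q); last first.
  by apply: clinP => v; rewrite [in RHS](addrC (clin_comp _ _)).
by apply: near_is_diff; apply: filterS dl => p dp /=; rewrite DopE.
Qed.

Lemma diff_dfunE (a v : Q) :
  'd (fun p => 'd l p a) q v = Dop (Dop l) q v a.
Proof. by have [_ ->] := is_diff_dfun a. Qed.

Lemma diff_energyE (v : Q) : 'd (energy l) q v =
  Dop l q (fiber_inj v.2) + Dop (Dop l) q v (fiber_inj q.2) - Dop l q v.
Proof. by have [_ ->] := is_diff_energy. Qed.

(** The terms D^2 l (w)(0, 0, y) coming from d theta and from the energy cancel. Splitting Dl v and
    Dl w into time, base and fibre parts cancels the time and fibre contributions; the base parts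
    complete the two values of [el_form]. *)
Lemma OmegaE (V : E) (w : Q) : Omega l q (1, q.2, V) w =
  w.1.1 * el_form l q V q.2 - el_form l q V w.1.2.
Proof.
pose v : Q := (1, q.2, V).
have OE a b c d a' b' c' d' : a = a' -> b = b' -> c = c' -> d = d' ->
    - (a - b) + (c * w.1.1 - d * 1) = - (a' - b') + (c' * w.1.1 - d') :> R.
  by move=> -> -> -> ->; rewrite mulr1.
have := OE _ _ _ _ _ _ _ _ (diff_dfunE (fiber_inj w.1.2) v)
  (diff_dfunE (fiber_inj q.2) w) (diff_energyE v) (diff_energyE w).
rewrite -[LHS]/(Omega l q v w) => ->; rewrite /el_form -/v.
have vE : Dop l q v = Dop l q (1, 0, 0) + Dop l q (base_inj q.2) +
    Dop l q (fiber_inj V).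
  by rewrite /v pair_split scale1r !linearD.
have wE : Dop l q w = w.1.1 * Dop l q (1, 0, 0) + Dop l q (base_inj w.1.2) +
    Dop l q (fiber_inj w.2).
  by case: w {OE} => [[s x] y]; rewrite [in LHS]pair_split !linearD linearZ.
rewrite vE wE -[v.2]/V; ring.
Qed.

Lemma Omega_kernelP (V : E) :
  (forall w, Omega l q (1, q.2, V) w = 0) <-> forall xi, el_form l q V xi = 0.
Proof.
split=> [H xi|H w]; last by rewrite OmegaE !H mulr0 subr0.
have := H (base_inj xi); rewrite OmegaE base_injE /= mul0r sub0r.
by move=> /eqP; rewrite oppr_eq0 => /eqP.
Qed.

End at_point.
End local_euler_lagrange.

(** * Solving the Euler-Lagrange equation for the acceleration in a chart *)

Section local_solution.
Context {R : realType} {E : completeNormedModType R}.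
Local Notation Q := (R * E * E)%type.
Local Notation i2 := (@base_inj R E).
Local Notation i3 := (@fiber_inj R E).

Lemma is_diff_fiber (W : normedModType R) (f : Q -> W) t x y (A : clin Q W) :
  is_diff (t, x, y) f A ->
  is_diff y (fun y' => f (t, x, y')) (clin_comp A i3).
Proof.
move=> df; have i3E y' : i3 y' + (t, x, 0) = (t, x, y').
  by rewrite fiber_injE -[LHS]/(0 + t, 0 + x, y' + 0) !add0r addr0.
have di := is_diff_clinDc (t, x, 0) (is_diff_clin i3 y).
rewrite -(i3E y) in df; have := is_diff_clin_comp di df.
by apply: near_is_diff; apply: nearW => y'; rewrite i3E.
Qed.

Lemma is_diff_base (W : normedModType R) (f : Q -> W) t x y (A : clin Q W) :
  is_diff (t, x, y) f A ->
  is_diff x (fun x' => f (t, x', y)) (clin_comp A i2).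
Proof.
move=> df; have i2E x' : i2 x' + (t, 0, y) = (t, x', y).
  by rewrite base_injE -[LHS]/(0 + t, x' + 0, 0 + y) !add0r addr0.
have di := is_diff_clinDc (t, 0, y) (is_diff_clin i2 x).
rewrite -(i2E x) in df; have := is_diff_clin_comp di df.
by apply: near_is_diff; apply: nearW => x'; rewrite i2E.
Qed.

Lemma partial3E (l : Q -> R) t x y : differentiable l (t, x, y) ->
  partial3 l t x y = clin_precomp R i3 (Dop l (t, x, y)).
Proof. by move=> /Dop_is_diff dl; apply: Dop_val; exact: is_diff_fiber. Qed.

Lemma partial2E (l : Q -> R) t x y : differentiable l (t, x, y) ->
  partial2 l t x y = clin_precomp R i2 (Dop l (t, x, y)).
Proof. by move=> /Dop_is_diff dl; apply: Dop_val; exact: is_diff_base. Qed.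

(** Restriction of a second derivative to fibre directions. As a bounded operator on D^2 l it
    preserves the class C^n. *)
Definition fiber_hess : clin (clin Q (clin Q R)) (clin E (clin E R)) :=
  clin_comp (clin_compb E (clin Q R) (clin E R) (clin_precomp R i3))
    (clin_precomp (clin Q R) i3).

Lemma partial33E (l : Q -> R) t x y : C2_at l (t, x, y) ->
  partial33 l t x y = fiber_hess (Dop (Dop l) (t, x, y)).
Proof.
move=> [dl /Dop_is_diff ddl]; apply: Dop_val.
have d1 := is_diff_fiber
  (is_diff_clin_comp ddl (is_diff_clin (clin_precomp R i3) _)).
apply: near_is_diff d1.
have c : {for y, continuous (fun y' => (t, x, y') : Q)}.
  apply: differentiable_continuous.
  by have [] := is_diff_fiber (is_diff_clin (clin_id Q) (t, x, y)).
have dl' : \forall y' \near y, differentiable l (t, x, y') := c _ dl.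
by apply: filterS dl' => y' dl'; rewrite partial3E.
Qed.

(** The part of [- el_form] without [V]: d_2 l - D(d_3 l)(1, y, 0), with y the fibre component of
    [q]. *)
Definition el_rhs (l : Q -> R) (q : Q) : clin E R :=
  clin_precomp R i2 (Dop l q) +
  (- clin_precomp R i3) (Dop (Dop l) q (i2 q.2 + (1, 0, 0))).

Lemma el_formE (l : Q -> R) q V xi :
  el_form l q V xi = fiber_hess (Dop (Dop l) q) V xi - el_rhs l q xi.
Proof.
have E1 : (1, q.2, V) = i2 q.2 + (1, 0, 0) + i3 V.
  by rewrite (pair_split 1) scale1r (addrC (i2 _)).
rewrite /el_form E1 (linearD (Dop (Dop l) q)).
rewrite -[LHS]/(Dop (Dop l) q (i2 q.2 + (1, 0, 0)) (i3 xi) +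
  Dop (Dop l) q (i3 V) (i3 xi) - Dop l q (i2 xi)).
rewrite -[RHS]/(Dop (Dop l) q (i3 V) (i3 xi) - (Dop l q (i2 xi)
  - Dop (Dop l) q (i2 q.2 + (1, 0, 0)) (i3 xi))).
by ring.
Qed.

Lemma el_formP (l : Q -> R) q V : (forall xi, el_form l q V xi = 0) <->
  fiber_hess (Dop (Dop l) q) V = el_rhs l q.
Proof.
split=> [H|H xi]; last by rewrite el_formE H subrr.
by apply: clinP => xi; apply/eqP; rewrite -subr_eq0 -el_formE H.
Qed.

(** A total function by choice; regularity makes the solution exist and be unique on the image of
    the chart. *)
Definition el_sol (l : Q -> R) (q : Q) : E :=
  get [set V | forall xi, el_form l q V xi = 0].

Section smooth.
Variables (U : set Q) (l : Q -> R).
Hypotheses (oU : open U) (Cl : smooth_on U l)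
  (Rl : forall t x y, U (t, x, y) -> is_toplinear_iso (partial33 l t x y)).

Lemma smooth_C2 q : U q -> C2_at l q.
Proof.
move=> Uq; have [dl [ddl _]] := Cl 2%N; split; last exact: ddl.
by have := open_nbhs_nbhs (conj oU Uq); apply: filterS => p; exact: dl.
Qed.

Lemma hess_iso q : U q -> is_toplinear_iso (fiber_hess (Dop (Dop l) q)).
Proof.
case: q => [[t x] y] Uq; rewrite -partial33E; first exact: Rl.
exact: smooth_C2.
Qed.

Lemma el_solP q : U q -> forall xi, el_form l q (el_sol l q) xi = 0.
Proof.
move=> Uq; have [B [_ BA]] := hess_iso Uq.
apply: (@getPex _ [set V | forall xi, el_form l q V xi = 0]).
by exists (B (el_rhs l q)); apply/el_formP; rewrite BA.
Qed.

Lemma el_sol_unique q V : U q -> (forall xi, el_form l q V xi = 0) ->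
  V = el_sol l q.
Proof.
move=> Uq /el_formP HV; have [B [AB _]] := hess_iso Uq.
have /el_formP H := el_solP Uq.
by rewrite -[LHS]AB HV -H AB.
Qed.

Lemma Ck_on_el_sol n : Ck_on n U (el_sol l).
Proof.
(* The coefficients involve first and second derivatives of [l], so class C^n of the solution uses
   class C^(n+2) of [l]. *)
have [_ CDl] := Cl n.+1; have [_ [_ CDDl]] := Cl n.+2.
apply: (@Ck_on_solve _ _ _ _ _ U (fun q => fiber_hess (Dop (Dop l) q))
  (el_rhs l)) => //.
- exact: hess_iso.
- exact: Ck_on_post.
- apply: Ck_onD => //; apply: Ck_on_post => //.
  apply: (@Ck_on_bilin _ _ _ _ _ _ U (clin_id (clin Q (clin Q R)))) => //.
  apply: Ck_onD => //; last exact: Ck_on_cst.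
  exact: (@Ck_on_clin _ _ _ _ U (clin_comp i2 (clin_snd _ _))).
- by move=> q /el_solP/el_formP.
Qed.

Lemma Ck_on_el_field n : Ck_on n U (fun q : Q => (1, q.2, el_sol l q) : Q).
Proof.
apply: (@eq_Ck_on _ _ _ _ _
  (fun q => (i2 q.2 + (1, 0, 0)) + i3 (el_sol l q))) => //.
  by move=> q Uq; rewrite [RHS]pair_split scale1r (addrC (i2 _)).
apply: Ck_onD => //; last by apply: Ck_on_post => //; exact: Ck_on_el_sol.
apply: Ck_onD => //; last exact: Ck_on_cst.
exact: (@Ck_on_clin _ _ _ _ U (clin_comp i2 (clin_snd _ _))).
Qed.

End smooth.
End local_solution.

(** * Change of chart *)

Section coordinate_change.
Context {R : realType} {E : completeNormedModType R}.
Local Notation Q := (R * E * E)%type.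
Local Notation i2 := (@base_inj R E).
Local Notation i3 := (@fiber_inj R E).

Definition time_inj : clin R Q :=
  clin_comp (clin_inl (R * E)%type E) (clin_inl R E).
Definition time_proj : clin Q R :=
  clin_comp (clin_fst R E) (clin_fst (R * E)%type E).
Definition base_proj : clin Q E :=
  clin_comp (clin_snd R E) (clin_fst (R * E)%type E).
Definition fiber_proj : clin Q E := clin_snd (R * E)%type E.

(* The transition map of R x TM induced by a transition map phi of M. *)
Definition tangent_map (phi : E -> E) (q : Q) : Q :=
  (q.1.1, phi q.1.2, Dop phi q.1.2 q.2).

Definition dtangent_map (phi : E -> E) (q : Q) : clin Q Q :=
  clin_comp time_inj time_proj +
  clin_comp i2 (clin_comp (Dop phi q.1.2) base_proj) +
  clin_comp i3 (clin_comp (clin_flip (Dop (Dop phi) q.1.2) q.2) base_proj +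
                clin_comp (Dop phi q.1.2) fiber_proj).

Lemma sum_inj (s : R) (x y : E) : time_inj s + i2 x + i3 y = (s, x, y).
Proof.
rewrite base_injE fiber_injE.
by rewrite -[LHS]/(s + 0 + 0, 0 + x + 0, 0 + 0 + y) !addr0 !add0r.
Qed.

Lemma dtangent_mapE phi q v : dtangent_map phi q v =
  (v.1.1, Dop phi q.1.2 v.1.2,
   Dop (Dop phi) q.1.2 v.1.2 q.2 + Dop phi q.1.2 v.2).
Proof. by rewrite -sum_inj. Qed.

Lemma dtangent_map_fiber phi (q : Q) xi :
  dtangent_map phi q (i3 xi) = i3 (Dop phi q.1.2 xi).
Proof.
rewrite dtangent_mapE [in RHS]fiber_injE /= !linear0.
by rewrite -[LHS]/(0, 0, 0 + Dop phi q.1.2 xi) add0r.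
Qed.

Lemma dtangent_map_base phi (q : Q) xi : dtangent_map phi q (i2 xi) =
  i2 (Dop phi q.1.2 xi) + i3 (Dop (Dop phi) q.1.2 xi q.2).
Proof.
rewrite dtangent_mapE -sum_inj /= !linear0 addr0.
by rewrite -[RHS]add0r addrA.
Qed.

Section local.
Variables (U : set E) (phi : E -> E).
Hypotheses (oU : open U) (Cphi : Ck_on 2 U phi).

Lemma is_diff_tangent_map (q : Q) : U q.1.2 ->
  is_diff q (tangent_map phi) (dtangent_map phi q).
Proof.
move=> Uq; have [dphi [ddphi _]] := Cphi.
have d2 := is_diff_clin base_proj q.
have dp := is_diff_clin_comp d2 (Dop_is_diff (dphi _ Uq)).
have ddp := is_diff_clin_comp d2 (Dop_is_diff (ddphi _ Uq)).
have db := is_diff_bilin (clin_id (clin E E)) ddp (is_diff_clin fiber_proj q).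
have e1 := is_diff_clin (clin_comp time_inj time_proj) q.
have e2 := is_diff_clin_comp dp (is_diff_clin i2 _).
have e3 := is_diff_clin_comp db (is_diff_clin i3 _).
have e := is_diff_clinD (is_diff_clinD e1 e2) e3.
apply: (is_diff_clin_ext e) => [p|v]; first by rewrite -[RHS]sum_inj.
by rewrite [RHS]dtangent_mapE -[RHS]sum_inj.
Qed.

Lemma near_base (q : Q) : U q.1.2 -> \forall p \near q, U p.1.2.
Proof.
move=> Uq; apply: (@clin_continuous _ _ _ base_proj q).
exact: open_nbhs_nbhs (conj oU Uq).
Qed.

(* Composing with f reduces the symmetry for E-valued maps to the real-valued
   case, where the mean value theorem applies. *)
Lemma functional_second_derivative_sym (f : clin E R) x v w : U x ->
  f (Dop (Dop phi) x v w) = f (Dop (Dop phi) x w v).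
Proof.
move=> Ux; have [dphi [ddphi _]] := Cphi.
have df y : U y -> is_diff y (fun z => f (phi z)) (clin_comp f (Dop phi y)).
  by move=> /dphi/Dop_is_diff d; exact: is_diff_clin_comp d (is_diff_clin f _).
have nU : \forall y \near x, U y by exact: open_nbhs_nbhs (conj oU Ux).
have nd : \forall y \near x, differentiable (fun z => f (phi z)) y.
  by apply: filterS nU => y /df[].
have e := is_diff_clin_comp (Dop_is_diff (ddphi _ Ux))
  (is_diff_clin (clin_compb E E R f) _).
have nD : {near x, (fun y => clin_compb E E R f (Dop phi y)) =1
    Dop (fun z => f (phi z))}.
  by apply: filterS nU => y /df/Dop_val ->.
by have := second_derivative_sym v w nd (near_is_diff nD e).
Qed.

Lemma el_form_tangent_map (l l' : Q -> R) (q : Q) V xi : U q.1.2 ->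
  C2_at l q -> C2_at l' (tangent_map phi q) ->
  {near q, l' \o tangent_map phi =1 l} ->
  el_form l q V xi = el_form l' (tangent_map phi q)
    (dtangent_map phi q (1, q.2, V)).2 (Dop phi q.1.2 xi).
Proof.
move=> Uq [dl ddl] [dl' ddl'] ll'; have [dphi [ddphi _]] := Cphi.
set T := tangent_map phi; set x := q.1.2.
have cT : {for q, continuous T}.
  by apply: differentiable_continuous; have [] := is_diff_tangent_map Uq.
have Dl : \forall p \near q,
    Dop l p = clin_comp (Dop l' (T p)) (dtangent_map phi p).
  have n1 : \forall p \near q, differentiable l' (T p) := cT _ dl'.
  have n2 : \forall p \near q, {near p, l' \o T =1 l}.
    by have := ll'; rewrite /prop_near1 => /near_join.
  apply: filterS3 n1 n2 (near_base Uq) => p d1 d2 Up.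
  apply: Dop_val; apply: near_is_diff d2 _.
  exact: is_diff_clin_comp (is_diff_tangent_map Up) (Dop_is_diff d1).
have dTq := is_diff_tangent_map Uq.
have dA := is_diff_clin_comp dTq (Dop_is_diff ddl').
have dphiq := is_diff_clin_comp (is_diff_clin base_proj q)
  (Dop_is_diff (ddphi _ Uq)).
have dB := is_diff_clin_comp dphiq
  (is_diff_clin (clin_comp i3 (clin_flip (clin_id (clin E E)) xi)) _).
have dAB := is_diff_bilin (clin_id (clin Q R)) dA dB.
have dL := is_diff_clin_comp (Dop_is_diff ddl)
  (is_diff_clin (clin_flip (clin_id (clin Q R)) (i3 xi)) _).
(* The chain rule is restricted to fibre vectors before it is differentiated again: only D phi
   occurs here, so no third derivative of phi arises. *)
have nAB : {near q, (fun p => Dop l' (T p) (i3 (Dop phi p.1.2 xi))) =1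
    (fun p => Dop l p (i3 xi))}.
  apply: filterS Dl => p Dlp.
  by rewrite Dlp clin_compE (dtangent_map_fiber phi p xi).
pose v : Q := (1, q.2, V).
have e1 : Dop (Dop l) q v (i3 xi) =
    Dop (Dop l') (T q) (dtangent_map phi q v) (i3 (Dop phi x xi)) +
    Dop l' (T q) (i3 (Dop (Dop phi) x q.2 xi)).
  have := Dop_val (near_is_diff nAB dAB); rewrite (Dop_val dL).
  by move=> /(congr1 (fun f : clin Q R => f v)).
(* The chain rule on base vectors yields D^2 phi (xi, y), whereas [e1] contains D^2 phi (y, xi);
   symmetry is applied under the functional Dl' on fibre vectors. *)
have e2 : Dop l q (i2 xi) = Dop l' (T q) (i2 (Dop phi x xi)) +
    Dop l' (T q) (i3 (Dop (Dop phi) x q.2 xi)).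
  rewrite (nbhs_singleton Dl) clin_compE (dtangent_map_base phi q xi).
  rewrite linearD; congr (_ + _).
  exact: (functional_second_derivative_sym
    (clin_comp (Dop l' (T q)) i3) xi q.2 Uq).
have e3 : dtangent_map phi q v = (1, (T q).2, (dtangent_map phi q v).2).
  by rewrite dtangent_mapE.
have e4 u : u = (1, (T q).2, u.2) -> el_form l' (T q) u.2 (Dop phi x xi) =
    Dop (Dop l') (T q) u (i3 (Dop phi x xi)) - Dop l' (T q) (i2 (Dop phi x xi)).
  by move=> uE; rewrite /el_form -uE.
have e5 : el_form l q V xi = Dop (Dop l) q v (i3 xi) - Dop l q (i2 xi) by [].
have cancel_sym L A B P N S K : L = A - B -> A = P + S -> B = N + S ->
    K = P - N -> L = K :> R.
  by move=> -> -> -> ->; ring.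
exact: cancel_sym e5 e1 e2 (e4 _ e3).
Qed.

End local.
End coordinate_change.

(** * The semispray of a regular Lagrangian *)

Lemma vector_field_eq (R : realType) (V : normedModType R) (N : charted V)
    (X Y : vector_field N) :
  (forall (c : chart N) (x : V), cod c x -> vf_loc X c x = vf_loc Y c x) ->
  X = Y.
Proof.
move=> XY; have vfE : vf X = vf Y.
  apply: functional_extensionality_dep => p; apply: tangent_eq.
  apply/funext => c.
  have [cp|ncp] := pselect (dom c p); last by rewrite !tcoord_out.
  have := XY c (Defs.coord c p) (ex_intro2 _ _ p cp erefl).
  by rewrite /vf_loc coordK.
case: X Y vfE {XY} => [X sX] [Y sY] /= vfE; rewrite vfE in sX *.
by rewrite (Prop_irrelevance sX sY).
Qed.

Lemma cod_overlap (R : realType) (V : normedModType R) (N : charted V)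
    (c : chart N) : cod c = Defs.coord c @` (dom c `&` dom c).
Proof. by rewrite setIid. Qed.

Lemma cod_open (R : realType) (V : normedModType R) (N : charted V)
  (c : chart N) : open (cod c).
Proof. by rewrite cod_overlap; exact: overlap_open. Qed.

Section manifold_spray.
Context {R : realType} {E : completeNormedModType R} (M : manifold E).
Local Notation Q := (R * E * E)%type.
Local Notation i2 := (@base_inj R E).
Local Notation i3 := (@fiber_inj R E).
Implicit Types (c d : chart M) (q : Q) (u : R * TM M).

(** Over a base point in the chart every time and every fibre coordinate occurs, the latter through
    [tangent_of]. *)
Lemma RTM_cod c q : cod (N := RTM M) c q <-> cod c q.1.2.
Proof.
split=> [[[t [p v]] cp <-]|[p cp px]]; first by exists p.
case: q px => [[t x] y] /= px.
exists (t, existT _ p (tangent_of c p y)) => //=.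
by rewrite /RTM_coord/= px /tangent_of_fun asboolT// diff_trans_id.
Qed.

Lemma RTM_transE c d u : RTM_dom c u -> RTM_dom d u ->
  tangent_map (trans c d) (RTM_coord c u) = RTM_coord d u.
Proof.
case: u => t [p v] cp dp; rewrite /tangent_map /RTM_coord /= trans_coord//.
by rewrite DopE ?(tcoord_trans v cp dp)//; exact: trans_differentiable.
Qed.

Definition overlap c d : set E := Defs.coord c @` (dom c `&` dom d).

Lemma RTM_overlap c d q : overlap c d q.1.2 ->
  exists2 w, RTM_dom c w /\ RTM_dom d w & RTM_coord c w = q.
Proof.
move=> [p [cp dp] pq]; exists (q.1.1, existT _ p (tangent_of c p q.2)) => //.
rewrite /RTM_coord /= /tangent_of_fun asboolT// diff_trans_id// pq.
by case: q {pq} => [[]].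
Qed.

Lemma near_overlap c d u : RTM_dom c u -> RTM_dom d u ->
  \forall q \near RTM_coord c u, overlap c d q.1.2.
Proof.
move=> cu du; apply: near_base; first exact: (@overlap_open _ _ M).
by exists (projT1 u.2).
Qed.

(** Identifies the germ of the abstract transition map of R x TM, whose derivative is thereby
    [dtangent_map]. *)
Lemma RTM_trans_near c d u : RTM_dom c u -> RTM_dom d u ->
  {near RTM_coord c u, tangent_map (trans c d) =1 trans (N := RTM M) c d}.
Proof.
move=> cu du; apply: filterS (near_overlap cu du) => q.
move=> /RTM_overlap[w [cw dw] <-].
rewrite RTM_transE// -[RHS]/(RTM_coord d (RTM_pt c (RTM_coord c w))).
by rewrite RTM_coordK.
Qed.

Section field.
Variables (L : RTM M -> R) (L_smooth : smooth_fun L) (L_regular : regular L).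

Lemma fun_loc_C2 c q : cod c q.1.2 -> C2_at (fun_loc L c) q.
Proof.
move=> /RTM_cod cq.
exact: (smooth_C2 (@cod_open _ _ (RTM M) c) (L_smooth c) cq).
Qed.

Lemma el_sol_chart c q : cod c q.1.2 ->
  forall xi, el_form (fun_loc L c) q (el_sol (fun_loc L c) q) xi = 0.
Proof.
move=> /RTM_cod cq.
exact: (el_solP (@cod_open _ _ (RTM M) c) (L_smooth c) (@L_regular c) cq).
Qed.

Lemma el_sol_chart_unique c q V : cod c q.1.2 ->
  (forall xi, el_form (fun_loc L c) q V xi = 0) -> V = el_sol (fun_loc L c) q.
Proof.
move=> /RTM_cod cq.
exact: (el_sol_unique (@cod_open _ _ (RTM M) c) (L_smooth c)
  (@L_regular c) cq).
Qed.

Definition el_vector c q : Q := (1, q.2, el_sol (fun_loc L c) q).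

Definition el_tcoord u : chart M -> Q := fun c =>
  if `[< RTM_dom c u >] then el_vector c (RTM_coord c u) else 0.

Lemma trans_Ck2 c d : Ck_on 2 (overlap c d) (trans c d).
Proof. exact: (@manifold_smooth _ _ M c d). Qed.

(** The transform of the solution in [c] solves the equation in [d] by invariance of [el_form],
    hence is the solution there by uniqueness. *)
Lemma el_vector_trans c d u : RTM_dom c u -> RTM_dom d u ->
  el_vector d (RTM_coord d u) =
  dtangent_map (trans c d) (RTM_coord c u) (el_vector c (RTM_coord c u)).
Proof.
move=> cu du; set q := RTM_coord c u.
have oo := @overlap_open _ _ M c d.
have ou : overlap c d q.1.2 by exists (projT1 u.2).
have cq : cod c q.1.2 by exists (projT1 u.2).
have dq : cod d (RTM_coord d u).1.2 by exists (projT1 u.2).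
have Tq : tangent_map (trans c d) q = RTM_coord d u by exact: RTM_transE.
have ll : {near q, fun_loc L d \o tangent_map (trans c d) =1 fun_loc L c}.
  apply: filterS (near_overlap cu du) => p /RTM_overlap[w [cw dw] <-].
  rewrite /fun_loc /= RTM_transE// -[LHS]/(L (RTM_pt d (RTM_coord d w))).
  by rewrite -[RHS]/(L (RTM_pt c (RTM_coord c w))) !RTM_coordK.
pose w := dtangent_map (trans c d) q (el_vector c q).
have wE : w = (1, (RTM_coord d u).2, w.2) by rewrite /w dtangent_mapE -Tq.
rewrite -/w [RHS]wE /el_vector; congr (_, _, _).
apply/esym; apply: el_sol_chart_unique => // eta.
(* Invariance speaks only of test vectors of the form D phi xi; the inverse transition map shows
   that every [eta] is one. *)
pose xi := 'd (trans d c) (Defs.coord d (projT1 u.2)) eta.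
have -> : eta = Dop (trans c d) q.1.2 xi.
  rewrite DopE; last exact: trans_differentiable.
  by rewrite diff_transK// diff_trans_id.
have C2d : C2_at (fun_loc L d) (tangent_map (trans c d) q).
  by rewrite Tq; exact: fun_loc_C2.
have h := el_form_tangent_map oo (@trans_Ck2 c d)
  (el_sol (fun_loc L c) q) xi ou (fun_loc_C2 cq) C2d ll.
rewrite -Tq; exact: etrans (esym h) (el_sol_chart cq xi).
Qed.

Lemma diff_RTM_trans c d u v : RTM_dom c u -> RTM_dom d u ->
  'd (trans (N := RTM M) c d) (RTM_coord c u) v =
  dtangent_map (trans c d) (RTM_coord c u) v.
Proof.
move=> cu du; have ou : overlap c d (RTM_coord c u).1.2 by exists (projT1 u.2).
have dT := is_diff_tangent_map (@trans_Ck2 c d) ou.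
by have [_ ->] := near_is_diff (RTM_trans_near cu du) dT.
Qed.

Lemma el_tcoord_trans u c d : RTM_dom c u -> RTM_dom d u ->
  el_tcoord u d = 'd (trans (N := RTM M) c d) (RTM_coord c u) (el_tcoord u c).
Proof.
move=> cu du; rewrite /el_tcoord !asboolT// diff_RTM_trans//.
exact: el_vector_trans.
Qed.

Lemma el_tcoord_out u c : ~ RTM_dom c u -> el_tcoord u c = 0.
Proof. by move=> ncu; rewrite /el_tcoord asboolF. Qed.

Definition el_tangent (u : RTM M) : tangent u :=
  Tangent (N := RTM M) (@el_tcoord_trans u) (@el_tcoord_out u).

Lemma el_tangent_loc c q : cod (N := RTM M) c q ->
  tcoord (el_tangent (RTM_pt c q)) c = el_vector c q.
Proof.
move=> [u cu <-]; rewrite RTM_coordK//.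
by rewrite /= /el_tcoord asboolT.
Qed.

Lemma el_tangent_smooth (c : chart (RTM M)) :
  smooth_on (cod c) (fun q => tcoord (el_tangent (pt c q)) c).
Proof.
move=> n; apply: (@eq_Ck_on _ n _ _ (cod c) (el_vector c)).
- exact: cod_open.
- by move=> q cq; rewrite el_tangent_loc.
- exact: (Ck_on_el_field (@cod_open _ _ (RTM M) c) (L_smooth c) (@L_regular c)).
Qed.

Definition el_field : vector_field (RTM M) := VectorField el_tangent_smooth.

Lemma el_field_loc (c : chart (RTM M)) q : cod c q ->
  vf_loc el_field c q = el_vector c q.
Proof. exact: el_tangent_loc. Qed.

Lemma el_field_semispray : semispray el_field.
Proof. by move=> c q cq; rewrite /spray_coef el_field_loc// opprK. Qed.

Lemma el_field_unit_time : unit_time el_field.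
Proof. by move=> c q cq; rewrite el_field_loc. Qed.

Lemma el_field_kernel : in_kernel_Omega L el_field.
Proof.
move=> c q cq; have /RTM_cod cq' := cq; rewrite el_field_loc//.
by apply/(Omega_kernelP (fun_loc_C2 cq') _) => xi; exact: el_sol_chart.
Qed.

Lemma kernel_el_form (Z : vector_field (RTM M)) (c : chart (RTM M)) q :
  semispray Z -> in_kernel_Omega L Z -> cod c q ->
  forall xi, el_form (fun_loc L c) q (vf_loc Z c q).2 xi = 0.
Proof.
move=> sZ kZ cq; have /RTM_cod cq' := cq.
apply/(Omega_kernelP (fun_loc_C2 cq') _) => w.
by rewrite -[RHS](kZ c q cq w) [in RHS]sZ// /spray_coef opprK.
Qed.

Lemma kernel_semispray_loc (Z : vector_field (RTM M)) (c : chart (RTM M)) q :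
  semispray Z -> in_kernel_Omega L Z -> cod c q -> vf_loc Z c q = el_vector c q.
Proof.
move=> sZ kZ cq; have /RTM_cod cq' := cq.
rewrite sZ// /spray_coef opprK /el_vector; congr (_, _, _).
by apply: el_sol_chart_unique => //; exact: kernel_el_form.
Qed.

Lemma el_field_unique (Z : vector_field (RTM M)) :
  semispray Z -> in_kernel_Omega L Z -> el_field = Z.
Proof.
move=> sZ kZ; apply: vector_field_eq => c q cq.
by rewrite (kernel_semispray_loc sZ kZ)// el_field_loc.
Qed.

(** * Geodesics and the Euler-Lagrange equation along a curve *)

Section curve.
Variables (Z : vector_field (RTM M)) (I : set R) (g : R -> M).
Hypotheses (Zs : semispray Z) (Zk : in_kernel_Omega L Z).
Hypothesis (gs : smooth_curve I g).

Section at_time.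
Variables (c : chart M) (s : R).
Hypotheses (Is : I s) (cs : dom c (g s)).

Let W := I `&` g @^-1` dom c.
Let x := Defs.coord c \o g.
Let gamma (r : R) : Q := (r, x r, derive1 x r).

Let oW : open W. Proof. by have [] := gs c. Qed.

Let Cx : Ck_on 2 W x. Proof. by have [_] := gs c; apply. Qed.

Let Ws : W s. Proof. by []. Qed.

Let derive1_Dop r : W r -> derive1 x r = Dop x r 1.
Proof.
by move=> Wr; have [dx _] := Cx; rewrite derive1E' ?DopE//; exact: dx.
Qed.

Let is_diff_x : is_diff s x (Dop x s).
Proof. by have [dx _] := Cx; exact/Dop_is_diff/dx. Qed.

Let nW : \forall r \near s, W r.
Proof. exact: open_nbhs_nbhs (conj oW Ws). Qed.

Let acc : clin R E := clin_flip (Dop (Dop x) s) 1.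

(** Near [s] the curve derivative is [Dop x] evaluated at 1, so the second Frechet derivative of [x]
    differentiates it. *)
Let is_diff_derive1 : is_diff s (derive1 x) acc.
Proof.
have [_ [ddx _]] := Cx.
have := is_diff_clin_comp (Dop_is_diff (ddx _ Ws))
  (is_diff_clin (clin_flip (clin_id (clin R E)) 1) _).
move=> /is_diff_clin_ext-/(_ (Dop x ^~ 1) acc (fun=> erefl) (fun=> erefl)).
by apply: near_is_diff; apply: filterS nW => r /derive1_Dop.
Qed.

Let derive1_derive1 : derive1 (derive1 x) s = acc 1.
Proof.
have [d1 d2] := is_diff_derive1.
by rewrite derive1E'// d2.
Qed.

(** The velocity (1, x', x'') at [s] of the lifted curve [gamma]. *)
Let v : Q := (1, (gamma s).2, derive1 (derive1 x) s).

Let dgamma : clin R Q :=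
  time_inj + clin_comp i2 (Dop x s) + clin_comp i3 acc.

Let is_diff_gamma : is_diff s gamma dgamma.
Proof.
have e1 := is_diff_clin (@time_inj R E) s.
have e2 := is_diff_clin_comp is_diff_x (is_diff_clin i2 _).
have e3 := is_diff_clin_comp is_diff_derive1 (is_diff_clin i3 _).
apply: (is_diff_clin_ext (is_diff_clinD (is_diff_clinD e1 e2) e3)) => // r.
by rewrite [RHS]/gamma -sum_inj.
Qed.

Let dgamma1 : dgamma 1 = v.
Proof.
rewrite /v derive1_derive1 /gamma /= derive1_Dop// -sum_inj.
by [].
Qed.

Let cod_gamma r : W r -> cod c (gamma r).1.2.
Proof. by move=> [_ cr]; exists (g r). Qed.

(** Near [s] the momentum is a bounded operator applied to DL along [gamma], so the chain rule gives
    its derivative in operator norm. *)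
Lemma momentum_is_derive :
  is_derive s 1 (fun r => partial3 (fun_loc L c) r (x r) (derive1 x r))
    (clin_precomp R i3 (Dop (Dop (fun_loc L c)) (gamma s) v)).
Proof.
have [_ ddl] := fun_loc_C2 (cod_gamma Ws).
have d := is_diff_clin_comp is_diff_gamma (Dop_is_diff ddl).
have e := is_diff_clin_comp d (is_diff_clin (clin_precomp R i3) _).
have n : {near s, (fun r => clin_precomp R i3 (Dop (fun_loc L c) (gamma r))) =1
    (fun r => partial3 (fun_loc L c) r (x r) (derive1 x r))}.
  apply: filterS nW => r /cod_gamma/fun_loc_C2[/nbhs_singleton dl _].
  by rewrite partial3E.
have := is_diff_is_derive (near_is_diff n e).
by rewrite !clin_compE dgamma1.
Qed.

(** The coefficient of [Z] is minus the local solution, so the geodesic equation says that x'' is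
    this solution. Tested on xi, the difference of the two sides of the Euler-Lagrange equation is
    [el_form] at x'', and uniqueness gives the converse. *)
Lemma geodesic_el_at :
  derive1 (derive1 x) s + spray_coef Z c (s, x s, derive1 x s) = 0 <->
  is_derive s 1 (fun r => partial3 (fun_loc L c) r (x r) (derive1 x r))
    (partial2 (fun_loc L c) s (x s) (derive1 x s)).
Proof.
have cq := cod_gamma Ws; have /RTM_cod cq' := cq.
have [/nbhs_singleton dl _] := fun_loc_C2 cq.
rewrite /spray_coef (kernel_semispray_loc Zs Zk)//=.
have dm := momentum_is_derive; rewrite partial2E//.
split=> [|[_ el]].
  move=> /eqP; rewrite subr_eq0 => /eqP acE.
  apply: is_derive_eq dm _; apply: clinP => xi.
  apply/eqP; rewrite -subr_eq0; apply/eqP.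
  have := el_sol_chart cq xi; rewrite -acE; exact.
apply/eqP; rewrite subr_eq0; apply/eqP.
apply: el_sol_chart_unique => // xi.
have [_ el'] := dm; rewrite el' in el.
have := congr1 (fun f : clin E R => f xi) el.
by move=> /eqP; rewrite -subr_eq0 => /eqP.
Qed.

End at_time.

Lemma geodesic_euler_lagrange : geodesic Z I g <-> euler_lagrange L I g.
Proof.
by split=> H c s Is cs; apply/(geodesic_el_at Is cs); exact: H.
Qed.

End curve.
End field.
End manifold_spray.

Theorem proposition3p4 (R : realType) (E : completeNormedModType R)
    (M : manifold E) (L : RTM M -> R)
    (L_smooth : smooth_fun L) (L_regular : regular L) :
  (exists! Z : vector_field (RTM M),
     semispray Z /\ unit_time Z /\ in_kernel_Omega L Z) /\
  (forall Z : vector_field (RTM M),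
     semispray Z -> unit_time Z -> in_kernel_Omega L Z ->
   forall (I : set R) (c : R -> M),
     open I -> is_interval I -> smooth_curve I c ->
     (geodesic Z I c <-> euler_lagrange L I c)).
Proof.
split=> [|Z sZ _ kZ I c _ _ gs]; last exact: geodesic_euler_lagrange.
exists (el_field L_smooth L_regular); split=> [|Z [sZ [_ kZ]]].
  split; first exact: el_field_semispray.
  by split; [exact: el_field_unit_time|exact: el_field_kernel].
exact: el_field_unique.
Qed.
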